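(* Fix $q\in(0,1)$ and, for $\theta=(\theta_i)_{i=1}^\infty\in\mathcal{N}$, let $P^\theta$ be the extreme $q$-central probability measure on $(\Omega,\mathcal{C})$ described in the context. Then: (1) If $\theta$ is constant, then $P^\theta$ is atomic with a single atom. (2) If $\theta$ is not constant but bounded, then $P^\theta$ is atomic with infinitely many atoms. (3) If $\theta$ is unbounded, then the Krieger--Araki--Woods ratio set of $(\Omega,\mathcal{C},P^\theta,\mathfrak{S})$ equals $\{q^{2n}\mid n\in\mathbb{Z}\}\cup\{0\}$ (i.e. the system is of type III$_{q^2}$).
   Context: Gelfand--Tsetlin graph: for $N\ge1$ let $\mathrm{Sign}_N=\{\lambda\in\mathbb{Z}^N\mid \lambda_1\ge\cdots\ge\lambda_N\}$, $\mathrm{Sign}_0=\{*\}$, and $|\lambda|=\lambda_1+\cdots+\lambda_N$. For $\mu\in\mathrm{Sign}_{N-1}$, $\lambda\in\mathrm{Sign}_N$ write $\mu\prec\lambda$ if $\lambda_1\ge\mu_1\ge\lambda_2\ge\cdots\ge\mu_{N-1}\ge\lambda_N$ (with $*\prec\lambda$ for all $\lambda\in\mathrm{Sign}_1$). Edges of level $N$ are pairs $[\mu,\lambda]$ with $\mu\in\mathrm{Sign}_{N-1},\lambda\in\mathrm{Sign}_N,\mu\prec\lambda$, with source $s([\mu,\lambda])=\mu$ and range $r([\mu,\lambda])=\lambda$. A path is a sequence of edges $(e_n)$ with $r(e_n)=s(e_{n+1})$. Weight: $w([\mu,\lambda])=q^{N|\mu|-(N-1)|\lambda|}$ for a level-$N$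 edge, and $w$ of a finite path is the product of the weights of its edges. For $\mu\in\mathrm{Sign}_K,\lambda\in\mathrm{Sign}_N$, $K<N$, $\dim_q(\mu,\lambda)=\sum_\alpha w(\alpha)$ over finite paths $\alpha$ from $\mu$ to $\lambda$, and $\dim_q(\lambda)=\dim_q( *,\lambda)$. $\Omega$ is the set of infinite paths starting at $*$; for a finite path $\alpha=(e_n)_{n=1}^N$ from $*$, $C_\alpha=\{\omega\in\Omega\mid \omega_n=e_n,\ n\le N\}$; $\mathcal{C}$ is the $\sigma$-algebra generated by these cylinder sets. A probability measure $P$ on $(\Omega,\mathcal{C})$ is $q$-central if $P(C_\alpha)/w(\alpha)=P(\{\omega\mid r(\omega_N)=\lambda\})/\dim_q(\lambda)$ for all $\lambda\in\mathrm{Sign}_N$ and all finite paths $\alpha$ from $*$ to $\lambda$. For $\lambda\in\mathrm{Sign}_N$, each permutation $\gamma_0$ of the set of finite paths from $*$ to $\lambda$ acts on $\Omega$ by $\gamma(\omega)=(\gamma_0(\omega_1,\dots,\omega_N),\omega_{N+1},\dots)$ if $r(\omega_N)=\lambda$ and $\gamma(\omega)=\omega$ otherwise; $\mathfrak{S}_N$ is the group generated by these transformations for all $\lambda\in\mathrm{Sign}_N$, and $\mathfrak{S}=\bigcup_N\mathfrak{S}_N$. $q$-central measures are $\mathfrak{S}$-quasi-invariant. Let $\mathcal{N}=\{\theta\in\mathbb{Z}^\infty\mid\theta_1\le\theta_2\le\cdots\}$ and $\lambda(n;\theta)=(\theta_n,\theta_{n-1},\dots,\theta_1)\in\mathrm{Sign}_n$.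 (Known fact, Gorin:) for each $\theta\in\mathcal{N}$ there is a unique $q$-central probability measure $P^\theta$ with $P^\theta(C_\alpha)/\dim_q(\lambda)=\lim_{n\to\infty}\dim_q(\lambda,\lambda(n;\theta))/\dim_q(\lambda(n;\theta))$ for every finite path $\alpha$ from $*$ to $\lambda\in\mathrm{Sign}_N$; these are exactly the extreme (equivalently $\mathfrak{S}$-ergodic) $q$-central probability measures. The full group $[\mathfrak{S}]$ consists of measurable transformations $\gamma$ of $\Omega$ such that for every $\omega$ there is $\gamma_0\in\mathfrak{S}$ with $\gamma(\omega)=\gamma_0(\omega)$. For an $\mathfrak{S}$-quasi-invariant probability measure $P$, the ratio set $r(\Omega,\mathcal{C},P,\mathfrak{S})$ is the set of $r\in[0,\infty)$ such that for every $\epsilon>0$ and every $A\in\mathcal{C}$ with $P(A)>0$ there exist $B\in\mathcal{C}$ and $\gamma\in[\mathfrak{S}]$ with $P(B)>0$, $B\subseteq A$, $\gamma(B)\subseteq A$ and $|\frac{dP\circ\gamma}{dP}(\omega)-r|<\epsilon$ for a.e. $\omega\in B$.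
   Formalization: The formula characterizing $P^\theta$ is corrected: $P^\theta(C_\alpha)/w(\alpha)$, not $P^\theta(C_\alpha)/\dim_q(\lambda)$, equals the limit; the printed version contradicts $q$-centrality for nonconstant $\theta$, e.g. $\theta=(0,1,1,\dots)$, $\lambda=(1,0)$. *)

(* Defs.v *)
From HB Require Import structures.
From mathcomp Require Import all_boot all_order all_algebra.
From mathcomp Require Import all_classical all_reals all_analysis.
From mathcomp Require Import measurable_realfun.
Set Implicit Arguments. Unset Strict Implicit. Unset Printing Implicit Defensive.
Import Order.TTheory GRing.Theory Num.Theory.
Import numFieldNormedType.Exports.
Local Open Scope classical_set_scope.
Local Open Scope ring_scope.

(* Sign_N : a signature is a non-increasing list of N integers;
   Sign_0 = { [::] } (the root * is the empty list). Index 0 of the list is lambda_1. *)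
Definition is_sign (N : nat) (s : seq int) : Prop :=
  size s = N /\ sorted (fun a b => b <= a) s.

Definition interlace (mu la : seq int) : Prop :=
  size la = (size mu).+1 /\
  forall i, (i < size mu)%N -> nth 0 la i.+1 <= nth 0 mu i <= nth 0 la i.

Definition sumi (s : seq int) : int := \sum_(x <- s) x.

Definition ew (R : unitRingType) (q : R) (mu la : seq int) : R :=
  q ^ ((size la)%:Z * sumi mu - ((size la)%:Z - 1) * sumi la).

(* A finite path is represented by its sequence of vertices
   [nu_K; nu_{K+1}; ...; nu_N] (the edges being the consecutive pairs). *)
Definition fpath (s : seq (seq int)) : Prop :=
  s <> [::] /\
  (forall i, (i < size s)%N -> is_sign (size (nth [::] s 0) + i) (nth [::] s i)) /\
  (forall i, (i.+1 < size s)%N -> interlace (nth [::] s i) (nth [::] s i.+1)).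

Definition paths_between (mu la : seq int) : set (seq (seq int)) :=
  [set s | fpath s /\ head [::] s = mu /\ last [::] s = la].

Definition paths_to (la : seq int) := paths_between [::] la.

Definition pw (R : unitRingType) (q : R) (s : seq (seq int)) : R :=
  \prod_(i < (size s).-1) ew q (nth [::] s i) (nth [::] s i.+1).

Definition dimq (R : realType) (q : R) (mu la : seq int) : R :=
  \sum_(s \in paths_between mu la) pw q s.

Definition dimq1 (R : realType) (q : R) (la : seq int) : R := dimq q [::] la.

(* An infinite path from * is given by its vertices x 0 = *, x 1, x 2, ...
   with x n in Sign_n and x n < x (n+1); the n-th edge is [x (n-1), x n]. *)
Definition is_ipath (x : nat -> seq int) : Prop :=
  forall n, is_sign n (x n) /\ interlace (x n) (x n.+1).

Definition Omega := {x : nat -> seq int | is_ipath x}.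

HB.instance Definition _ := gen_eqMixin Omega.
HB.instance Definition _ := gen_choiceMixin Omega.


Lemma zero_ipath : is_ipath (fun n => nseq n (0 : int)).
Proof.
move=> n; split; first split.
- by rewrite size_nseq.
- by elim: n => [|[|n] IH] //=.
- split; first by rewrite !size_nseq.
  by move=> i _; rewrite !nth_nseq; do 3 case: (_ < _)%N.
Qed.

HB.instance Definition _ := isPointed.Build Omega (exist _ _ zero_ipath).

Definition vert (w : Omega) : nat -> seq int := proj1_sig w.

Definition cyl (a : seq (seq int)) : set Omega :=
  [set w | forall i, (i < size a)%N -> vert w i = nth [::] a i].

Definition from_star : set (seq (seq int)) :=
  [set s | fpath s /\ head [::] s = [::]].

Definition cylinders : set (set Omega) := [set cyl a | a in from_star].

Definition OmegaM := g_sigma_algebraType cylinders.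

Definition level (N : nat) (la : seq int) : set OmegaM :=
  [set w | vert w N = la].

Definition q_central (R : realType) (q : R) (P : probability OmegaM R) : Prop :=
  forall (N : nat) (la : seq int) (a : seq (seq int)),
    is_sign N la -> paths_to la a ->
    fine (P (cyl a)) / pw q a = fine (P (level N la)) / dimq1 q la.

(* lambda(n; theta) = (theta_n, ..., theta_1); theta is 0-indexed: theta 0 = theta_1 *)
Definition lam_theta (theta : nat -> int) (n : nat) : seq int :=
  rev (mkseq theta n).

Definition is_P_theta (R : realType) (q : R) (theta : nat -> int)
    (P : probability OmegaM R) : Prop :=
  forall (N : nat) (la : seq int) (a : seq (seq int)),
    is_sign N la -> paths_to la a ->
    (fun n : nat => dimq q la (lam_theta theta n) / dimq1 q (lam_theta theta n))
      @ \oo --> fine (P (cyl a)) / pw q a.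

Definition perm_on_set (T : Type) (A : set T) (g : T -> T) : Prop :=
  (forall x, A x -> A (g x)) /\
  (forall x y, A x -> A y -> g x = g y -> x = y) /\
  (forall y, A y -> exists2 x, A x & g x = y).

Definition gen_raw (N : nat) (g0 : seq (seq int) -> seq (seq int))
    (w : Omega) : nat -> seq int :=
  fun n => if (n <= N)%N then nth [::] (g0 (mkseq (vert w) N.+1)) n else vert w n.

Definition gen_act (N : nat) (la : seq int) (g0 : seq (seq int) -> seq (seq int))
    (w : Omega) : Omega :=
  if vert w N == la then
    match pselect (is_ipath (gen_raw N g0 w)) with
    | left p => exist _ _ p
    | right _ => w
    end
  else w.

Inductive frakS : (Omega -> Omega) -> Prop :=
  | frakS_gen N la g0 : is_sign N la -> perm_on_set (paths_to la) g0 ->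
      frakS (gen_act N la g0)
  | frakS_id : frakS id
  | frakS_comp g h : frakS g -> frakS h -> frakS (g \o h)
  | frakS_inv g h : frakS g -> cancel g h -> cancel h g -> frakS h.

Definition full_group (g : OmegaM -> OmegaM) : Prop :=
  measurable_fun setT g /\
  (exists h : OmegaM -> OmegaM, measurable_fun setT h /\ cancel g h /\ cancel h g) /\
  (forall w, exists g0, frakS g0 /\ g w = g0 w).

Definition is_RN_deriv (R : realType) (P : probability OmegaM R)
    (g : OmegaM -> OmegaM) (f : OmegaM -> \bar R) : Prop :=
  measurable_fun setT f /\ (forall w, (0 <= f w)%E) /\
  forall A, measurable A -> P (g @` A) = (\int[P]_(w in A) f w)%E.

Definition ratio_set (R : realType) (P : probability OmegaM R) : set R :=
  [set r | 0 <= r /\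
    forall eps : R, 0 < eps ->
    forall A : set OmegaM, measurable A -> (0 < P A)%E ->
    exists (B : set OmegaM) (g : OmegaM -> OmegaM),
      [/\ measurable B, full_group g, (0 < P B)%E, B `<=` A & g @` B `<=` A] /\
      exists f, is_RN_deriv P g f /\
        {ae P, forall w, B w -> (`| f w - r%:E | < eps%:E)%E}].

Definition atom (R : realType) (P : probability OmegaM R) (A : set OmegaM) : Prop :=
  [/\ measurable A, (0 < P A)%E &
      forall B, measurable B -> B `<=` A -> P B = 0%E \/ P B = P A].

Definition purely_atomic (R : realType) (P : probability OmegaM R) : Prop :=
  forall A, measurable A -> (0 < P A)%E -> exists B, B `<=` A /\ atom P B.

Definition atomic_single (R : realType) (P : probability OmegaM R) : Prop :=
  purely_atomic P /\
  exists A, atom P A /\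
    forall B, atom P B -> P ((A `\` B) `|` (B `\` A)) = 0%E.

Definition atomic_infinite (R : realType) (P : probability OmegaM R) : Prop :=
  purely_atomic P /\
  forall n : nat, exists F : nat -> set OmegaM,
    (forall i, (i < n)%N -> atom P (F i)) /\
    (forall i j, (i < n)%N -> (j < n)%N -> i <> j -> F i `&` F j = set0).

(* Main.v *)
(** Every finite path is, up to its last vertex, weighted by [q] to the power
    twice the sum of all entries of its rows. Hence for [gamma] in the full
    group, [dP o gamma / dP] is [q ^ (2 * k)], with [k] the (finite) total change
    of these sums, and the ratio set lies in [{q ^ (2 n)} u {0}].

    The [i]-th smallest entry of row [n] decreases with [n], and approximating
    [P] by the weights of paths to [lambda(m; theta)] shows that it is almost
    surely at least [theta_i], and at most [sup theta].

    If [theta] is unbounded, so is the largest entry of row [n]. Infinitely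
    often it grows, and then it can be moved by one unit while rows [n - 1] and
    [n + 1] stay fixed. Moving it at the first such level after [N] (among the
    levels of a fixed parity, so that the choice of the level is not disturbed)
    is an involution that fixes the first [N] rows, and a fixed proportion of
    the paths are moved up by it, with derivative [q ^ 2]. As any event is
    approximated by events depending on finitely many rows, [q ^ 2] is in the
    ratio set, even with [eps = 0]; ratios of this kind form a group.

    If [theta] is eventually equal to [c], almost every path eventually only
    gains entries [c], so [P] is carried by a countable set. If moreover
    [theta_1 < c], an injection of paths gives [P (first row = c) <= q ^ 2], so
    some path with an entry less than [c] is charged; so are then the infinitely
    many paths with the same tail. *)
Require Import Defs.
From HB Require Import structures.
From mathcomp Require Import all_boot all_order all_algebra.
From mathcomp Require Import all_classical all_reals all_analysis.
From mathcomp Require Import measurable_realfun.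
From mathcomp Require Import zify ring lra.
Import Order.TTheory GRing.Theory Num.Theory numFieldNormedType.Exports.
Local Open Scope classical_set_scope.
Local Open Scope ring_scope.

(** * Paths and exchanges of initial segments *)

Lemma vert_sign (w : Omega) n : is_sign n (vert w n).
Proof. by case: w => x hx; case: (hx n). Qed.

Lemma vert_interlace (w : Omega) n : interlace (vert w n) (vert w n.+1).
Proof. by case: w => x hx; case: (hx n). Qed.

Lemma size_vert (w : Omega) n : size (vert w n) = n.
Proof. by case: (vert_sign w n). Qed.

Lemma vert0 (w : Omega) : vert w 0 = [::].
Proof. by apply: size0nil; rewrite size_vert. Qed.

Lemma vert_inj (w w' : Omega) : (forall n, vert w n = vert w' n) -> w = w'.
Proof.
case: w w' => [x hx] [y hy] /= h.
have exy : x = y by apply/funext => n; exact: h.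
by subst y; congr exist; exact: Prop_irrelevance.
Qed.

Definition trunc (w : Omega) (N : nat) : seq (seq int) := mkseq (vert w) N.+1.

Lemma size_trunc w N : size (trunc w N) = N.+1.
Proof. by rewrite size_mkseq. Qed.

Lemma nth_trunc w N i : (i <= N)%N -> nth [::] (trunc w N) i = vert w i.
Proof. by move=> iN; rewrite nth_mkseq. Qed.

Lemma trunc_eqP w w' N :
  trunc w N = trunc w' N <-> (forall i, (i <= N)%N -> vert w i = vert w' i).
Proof.
split=> [e i iN|e]; first by rewrite -!(@nth_trunc _ N)// e.
apply: (@eq_from_nth _ [::]); first by rewrite !size_trunc.
by move=> i; rewrite size_trunc ltnS => iN; rewrite !nth_trunc ?e.
Qed.

Lemma trunc_path w N : paths_to (vert w N) (trunc w N).
Proof.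
have n0 : nth [::] (trunc w N) 0 = [::] by rewrite nth_trunc// vert0.
split; [split|split].
- by move=> /(congr1 size); rewrite size_trunc.
- split=> i; rewrite size_trunc ltnS => iN.
    by rewrite n0 nth_trunc //; exact: vert_sign.
  by rewrite !nth_trunc ?(ltnW iN)//; exact: vert_interlace.
- by rewrite -nth0 n0.
- by rewrite -nth_last size_trunc nth_trunc.
Qed.

Lemma trunc_from_star w N : from_star (trunc w N).
Proof. by have [? []] := trunc_path w N. Qed.

Lemma cyl_trunc w N w' : cyl (trunc w N) w' <-> trunc w' N = trunc w N.
Proof.
rewrite trunc_eqP; split=> h i.
  by move=> iN; rewrite h ?size_trunc// nth_trunc.
by rewrite size_trunc ltnS => iN; rewrite h// nth_trunc.
Qed.

Lemma cyl_truncE {a N w} : size a = N.+1 -> cyl a w <-> trunc w N = a.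
Proof.
move=> sa; split=> [h|<-].
  apply: (@eq_from_nth _ [::]); first by rewrite size_trunc.
  by move=> i; rewrite size_trunc => iN; rewrite nth_trunc// h// sa.
by move=> i; rewrite size_trunc ltnS => iN; rewrite nth_trunc.
Qed.

Lemma from_star_size_nth {a i} :
  from_star a -> (i < size a)%N -> size (nth [::] a i) = i.
Proof.
move=> [[_ [h _]] h0] ia; have [-> _] := h _ ia.
by rewrite nth0 h0.
Qed.

Lemma paths_to_size {N la a} :
  is_sign N la -> paths_to la a -> size a = N.+1.
Proof.
move=> [sla _] [fa [ha la_]].
have fs : from_star a by split.
have a0 : (0 < size a)%N by case: a fa {ha la_ fs} => // -[].
have := @from_star_size_nth a (size a).-1 fs.
rewrite nth_last la_ sla prednK// => /(_ (leqnn _)) ->.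
by rewrite prednK.
Qed.

Lemma splice_ipath N a w : from_star a -> size a = N.+1 ->
  last [::] a = vert w N ->
  is_ipath (fun n => if (n <= N)%N then nth [::] a n else vert w n).
Proof.
move=> fa sa la n; have [[a0 [h1 h2]] h0] := fa.
have aN : nth [::] a N = vert w N by rewrite -la -nth_last sa.
split.
  case: ifP => nN; last exact: vert_sign.
  by have := h1 n; rewrite sa ltnS nth0 h0 add0n; apply.
case: (ltngtP n N) => [nN|nN|->].
- by apply: h2; rewrite sa ltnS.
- exact: vert_interlace.
- by rewrite aN; exact: vert_interlace.
Qed.

(** * Tail equivalence, which turns out to be the orbit relation of the group *)

Definition tail_eq (N : nat) (w w' : Omega) : Prop :=
  forall n, (N <= n)%N -> vert w n = vert w' n.

Lemma tail_eq_sym N w w' : tail_eq N w w' -> tail_eq N w' w.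
Proof. by move=> h n Nn; rewrite h. Qed.

Lemma tail_eq_trans N w w' w'' :
  tail_eq N w w' -> tail_eq N w' w'' -> tail_eq N w w''.
Proof. by move=> h h' n Nn; rewrite h// h'. Qed.

Lemma tail_eq_le N M w w' : (N <= M)%N -> tail_eq N w w' -> tail_eq M w w'.
Proof. by move=> NM h n Mn; apply: h; exact: leq_trans Mn. Qed.

(** As [g0] maps paths to [la] to paths to [la], the spliced sequence is again a path, so the
    default branches of [gen_act] do not occur here. *)
Lemma gen_act_vert N la g0 w n : is_sign N la -> perm_on_set (paths_to la) g0 ->
  vert w N = la ->
  vert (gen_act N la g0 w) n =
    if (n <= N)%N then nth [::] (g0 (trunc w N)) n else vert w n.
Proof.
move=> sla [g0P _] wN; rewrite /gen_act wN eqxx.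
have pg : paths_to la (g0 (trunc w N)) by apply: g0P; rewrite -wN; exact: trunc_path.
have ip : is_ipath (gen_raw N g0 w).
  apply: splice_ipath.
  - by case: pg => ? [].
  - exact: paths_to_size pg.
  - by rewrite wN; case: pg => _ [].
by case: pselect.
Qed.

Lemma gen_act_tail N la g0 w : is_sign N la -> perm_on_set (paths_to la) g0 ->
  tail_eq N w (gen_act N la g0 w).
Proof.
move=> sla pg n Nn.
have [wN|wN] := eqVneq (vert w N) la; last by rewrite /gen_act (negbTE wN).
rewrite gen_act_vert//; case: ifP => // nN.
have -> : n = N by apply/eqP; rewrite eqn_leq nN Nn.
have [g0P _] := pg.
have pg' : paths_to la (g0 (trunc w N)) by apply: g0P; rewrite -wN; exact: trunc_path.
rewrite wN; case: (pg') => _ [_ <-].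
by rewrite -nth_last (paths_to_size sla pg').
Qed.

(** One level serves all paths at once: a composition takes the maximum of two levels, an inverse
    keeps its level. *)
Lemma frakS_tail g : frakS g -> exists N, forall w, tail_eq N w (g w).
Proof.
elim=> [N la g0 sla pg||{}g h _ [N hN] _ [M hM]|{}g h _ [N hN] gh hg].
- by exists N => w; exact: gen_act_tail.
- by exists 0%N.
- exists (maxn N M) => w; apply: (@tail_eq_trans _ _ (h w)).
    by apply: tail_eq_le (hM w); exact: leq_maxr.
  by apply: tail_eq_le (hN (h w)); exact: leq_maxl.
- by exists N => w; apply: tail_eq_sym; rewrite -{2}(hg w).
Qed.

(** * Transpositions of two finite paths with the same end *)

Definition swap_paths (a b s : seq (seq int)) :=
  if s == a then b else if s == b then a else s.

Lemma swap_pathsK a b : involutive (swap_paths a b).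
Proof.
move=> s; rewrite /swap_paths.
case: (eqVneq s a) => [->|sa].
  by case: (eqVneq b a) => [->//|]; rewrite eqxx.
case: (eqVneq s b) => [->|sb]; first by rewrite eqxx.
by rewrite (negbTE sa) (negbTE sb).
Qed.

Lemma swap_paths_perm la a b : paths_to la a -> paths_to la b ->
  perm_on_set (paths_to la) (swap_paths a b).
Proof.
move=> pa pb.
have h s : paths_to la s -> paths_to la (swap_paths a b s).
  by rewrite /swap_paths; case: ifP => // _; case: ifP.
split; [exact: h|split].
- by move=> x y _ _ /(can_inj (swap_pathsK a b)).
- by move=> y py; exists (swap_paths a b y); [exact: h|exact: swap_pathsK].
Qed.

Definition swap_act (N : nat) (la : seq int) a b : Omega -> Omega :=
  gen_act N la (swap_paths a b).

Section SwapAct.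
Variables (N : nat) (la : seq int) (a b : seq (seq int)).
Hypotheses (sla : is_sign N la) (pa : paths_to la a) (pb : paths_to la b).
Let sp := swap_paths_perm _ _ _ pa pb.

Lemma swap_act_frakS : frakS (swap_act N la a b).
Proof. exact: frakS_gen. Qed.

Lemma swap_act_tail w : tail_eq N w (swap_act N la a b w).
Proof. exact: gen_act_tail. Qed.

Lemma trunc_swap_act w : vert w N = la ->
  trunc (swap_act N la a b w) N = swap_paths a b (trunc w N).
Proof.
move=> wN; have [g0P _] := sp.
have pg : paths_to la (swap_paths a b (trunc w N)).
  by apply: g0P; rewrite -wN; exact: trunc_path.
apply: (@eq_from_nth _ [::]).
  by rewrite size_trunc (paths_to_size sla pg).
move=> i; rewrite size_trunc ltnS => iN.
by rewrite nth_trunc// gen_act_vert// iN.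
Qed.

Lemma swap_actK : involutive (swap_act N la a b).
Proof.
move=> w.
have [wN|wN] := eqVneq (vert w N) la; last first.
  by rewrite /swap_act/gen_act (negbTE wN) (negbTE wN).
have w'N : vert (swap_act N la a b w) N = la by rewrite -swap_act_tail.
have et : trunc (swap_act N la a b (swap_act N la a b w)) N = trunc w N.
  by rewrite !trunc_swap_act// swap_pathsK.
apply: vert_inj => n; case: (leqP n N) => nN.
  by move/trunc_eqP: et => ->.
by rewrite -!swap_act_tail// ltnW.
Qed.

Lemma cyl_vert w : cyl a w -> vert w N = la.
Proof.
have sa := paths_to_size sla pa.
move=> /(_ N); rewrite sa => -> //.
by case: pa => _ [_ <-]; rewrite -nth_last sa.
Qed.

Lemma swap_act_cyl w : cyl a w -> cyl b (swap_act N la a b w).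
Proof.
move=> wa; have wN := cyl_vert _ wa.
have sa := paths_to_size sla pa; have sb := paths_to_size sla pb.
apply/(cyl_truncE sb); rewrite trunc_swap_act//.
by move/(cyl_truncE sa): wa => ->; rewrite /swap_paths eqxx.
Qed.
End SwapAct.

Lemma swap_actC N la a b : swap_act N la a b = swap_act N la b a.
Proof.
rewrite /swap_act; congr gen_act; apply/funext => s; rewrite /swap_paths.
by case: eqVneq => [->|]; case: eqVneq => // ->.
Qed.

(** A single generator, the transposition of the initial segments, relates any two tail-equivalent
    paths. With [frakS_tail], the orbits are exactly the tail classes. *)
Lemma swap_act_trunc (w w' : Omega) N : tail_eq N w w' ->
  swap_act N (vert w N) (trunc w N) (trunc w' N) w = w'.
Proof.
move=> ww'; have wN := ww' N (leqnn N).
have pa := trunc_path w N; have pb := trunc_path w' N; rewrite -wN in pb.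
have sla := vert_sign w N.
have h : cyl (trunc w' N) (swap_act N (vert w N) (trunc w N) (trunc w' N) w).
  by apply: swap_act_cyl => //; apply/cyl_trunc.
move/cyl_trunc/trunc_eqP: h => h.
apply: vert_inj => n; case: (leqP n N) => nN; first exact: h.
by rewrite -ww' ?(ltnW nN)// -swap_act_tail// ltnW.
Qed.

(** Orbits of [frakS] being tail classes, the pointwise condition can be checked without producing
    group elements. *)
Lemma full_groupP (g : OmegaM -> OmegaM) : full_group g <->
  [/\ measurable_fun setT g,
      exists h : OmegaM -> OmegaM, [/\ measurable_fun setT h, cancel g h & cancel h g]
    & forall w, exists N, tail_eq N w (g w)].
Proof.
split=> [[mg [[h [mh [gh hg]]] gS]]|[mg [h [mh gh hg]] gt]].
  split=> //; first by exists h.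
  by move=> w; have [g0 [/frakS_tail [N hN] ->]] := gS w; exists N.
split=> //; split; first by exists h.
move=> w; have [N wN] := gt w; rewrite -(swap_act_trunc _ _ _ wN).
exists (swap_act N (vert w N) (trunc w N) (trunc (g w) N)); split=> //.
apply: swap_act_frakS; [exact: vert_sign|exact: trunc_path|].
by rewrite wN//; exact: trunc_path.
Qed.

(** The sum of an inner row [i] gets the coefficient [i + 1] from the edge leaving it and [-(i - 1)]
    from the edge entering it, together 2. The last row only has the contribution of its entering
    edge. *)
Lemma prod_ewE (R : realType) (q : R) (f : nat -> seq int) K : q != 0 ->
  (forall i, (i <= K)%N -> size (f i) = i) ->
  \prod_(i < K) ew q (f i) (f i.+1) =
  q ^ (2 * (\sum_(i < K) sumi (f i)) - (K%:Z - 1) * sumi (f K)).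
Proof.
move=> q0; elim: K => [|K IH] sf.
  rewrite !big_ord0 /sumi.
  by rewrite (size0nil (sf 0%N (leqnn 0))) big_nil !mulr0.
rewrite !big_ord_recr/= IH; last by move=> i iK; apply: sf; exact: leqW.
rewrite /ew -expfzDr// (sf K.+1)//; congr (q ^ _).
rewrite intS; ring.
Qed.

(** Row [N] is left out: its coefficient in the exponent depends on [N], and it cancels when two
    paths with the same end are compared. *)
Definition height (f : nat -> seq int) (N : nat) : int := \sum_(i < N) sumi (f i).

Lemma pwE (R : realType) (q : R) a : q != 0 -> from_star a ->
  pw q a = q ^ (2 * height (nth [::] a) (size a).-1 -
     ((size a).-1%:Z - 1) * sumi (last [::] a)).
Proof.
move=> q0 fa; rewrite /pw -nth_last -prod_ewE//.
move=> i ia; apply: from_star_size_nth => //.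
by case: fa => -[] a0 _ _; case: a a0 ia.
Qed.

Lemma pw_truncE (R : realType) (q : R) w N : q != 0 ->
  pw q (trunc w N) = q ^ (2 * height (vert w) N - (N%:Z - 1) * sumi (vert w N)).
Proof.
move=> q0; rewrite pwE//; last exact: trunc_from_star.
rewrite size_trunc/=; congr (q ^ (2 * _ - _ * sumi _)).
  by apply: eq_bigr => i _; rewrite nth_trunc// ltnW.
by have [_ []] := trunc_path w N.
Qed.

(** * Measurability, and the effect of an exchange on the measure *)

Lemma measurable_cyl a : from_star a -> measurable (cyl a : set OmegaM).
Proof. by move=> fa; apply: sub_sigma_algebra; exists a. Qed.

Lemma measurable_trunc N (Q : set (seq (seq int))) :
  measurable ([set w | Q (trunc w N)] : set OmegaM).
Proof.
(* Finite lists of rows form a countable type, so the event is a countable union of cylinders. *)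
have -> : [set w | Q (trunc w N)] = \bigcup_(a : seq (seq int))
    (if `[< Q a /\ from_star a /\ size a = N.+1 >] then cyl a else set0).
  apply/seteqP; split=> w /=.
    move=> Qw; exists (trunc w N) => //; rewrite asboolT; first exact/cyl_trunc.
    by split=> //; split; [exact: trunc_from_star|exact: size_trunc].
  by move=> [a _]; case: asboolP => // -[Qa [fa sa]] /(cyl_truncE sa) ->.
apply: countable_bigcupT_measurable; first exact: countableP.
move=> a; case: asboolP => [[_ [fa _]]|_]; last exact: measurable0.
exact: measurable_cyl.
Qed.

Lemma measurable_trunc2 (g : OmegaM -> OmegaM) N M
    (Q : seq (seq int) -> set (seq (seq int))) : measurable_fun setT g ->
  measurable ([set w | Q (trunc w N) (trunc (g w) M)] : set OmegaM).
Proof.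
move=> mg.
have -> : [set w | Q (trunc w N) (trunc (g w) M)] = \bigcup_(a : seq (seq int))
    ([set w | trunc w N = a] `&` (setT `&` g @^-1` [set w | Q a (trunc w M)])).
  apply/seteqP; split=> w /=; first by move=> Qw; exists (trunc w N).
  by move=> [a _ [<- []]].
apply: countable_bigcupT_measurable; first exact: countableP.
move=> a; apply: measurableI.
  by apply: (measurable_trunc N [set t | t = a]).
by apply: mg; [exact: measurableT|exact: measurable_trunc].
Qed.

Lemma trunc_last w N : last [::] (trunc w N) = vert w N.
Proof. by have [_ []] := trunc_path w N. Qed.

Lemma measurable_tail_eq (g : OmegaM -> OmegaM) N : measurable_fun setT g ->
  measurable ([set w | tail_eq N w (g w)] : set OmegaM).
Proof.
move=> mg.
have -> : [set w | tail_eq N w (g w)] = \bigcap_n [set w |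
    (N <= n)%N -> last [::] (trunc w n) = last [::] (trunc (g w) n)].
  apply/seteqP; split=> w; first by move=> h n _ Nn; rewrite !trunc_last; exact: h.
  by move=> h n Nn; rewrite -!trunc_last; exact: (h n I).
apply: bigcapT_measurable => n.
exact: (measurable_trunc2 g n n
  (fun s t => (N <= n)%N -> last [::] s = last [::] t)).
Qed.

Lemma height_trunc w N : height (vert w) N = height (nth [::] (trunc w N)) N.
Proof. by apply: eq_bigr => i _; rewrite nth_trunc// ltnW. Qed.

Lemma height_tail N M w w' : tail_eq N w w' -> (N <= M)%N ->
  height (vert w') M - height (vert w) M = height (vert w') N - height (vert w) N.
Proof.
move=> ww'; elim: M => [|M IH]; first by rewrite leqn0 => /eqP ->.
rewrite leq_eqVlt => /orP[/eqP <-//|]; rewrite ltnS => NM.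
by rewrite /height !big_ord_recr/= -!/(height _ _) -ww'//; have := IH NM; lia.
Qed.

(** Half the exponent of [q] in the Radon-Nikodym derivative. By [cocycleE] every common level gives
    the same value; without a common tail the default level 0 gives 0. *)
Definition cocycle (w w' : Omega) : int :=
  let N := xget 0%N [set N | tail_eq N w w'] in height (vert w') N - height (vert w) N.

Lemma cocycleE N w w' : tail_eq N w w' ->
  cocycle w w' = height (vert w') N - height (vert w) N.
Proof.
rewrite /cocycle; case: xgetP => [M _ h1 h2|/(_ N)//].
case: (leqP N M) => NM; first exact: height_tail.
by apply/esym/height_tail => //; exact: ltnW.
Qed.

Lemma cocycle_trans N w w' w'' : tail_eq N w w' -> tail_eq N w' w'' ->
  cocycle w w'' = cocycle w w' + cocycle w' w''.
Proof.
move=> h h'; rewrite (cocycleE _ _ _ h) (cocycleE _ _ _ h').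
by rewrite (cocycleE _ _ _ (tail_eq_trans _ _ _ _ h h')); ring.
Qed.

Lemma measurable_cocycle (g : OmegaM -> OmegaM) (Q : set int) :
  measurable_fun setT g -> (forall w, exists N, tail_eq N w (g w)) ->
  measurable ([set w | Q (cocycle w (g w))] : set OmegaM).
Proof.
move=> mg gt.
have -> : [set w | Q (cocycle w (g w))] = \bigcup_N
   ([set w | tail_eq N w (g w)] `&` [set w | Q (height (nth [::] (trunc (g w) N)) N
      - height (nth [::] (trunc w N)) N)]).
  apply/seteqP; split=> w /=.
    move=> Qw; have [N h] := gt w; exists N => //; split => //=.
    by rewrite -!height_trunc -(cocycleE _ _ _ h).
  by move=> [N _ [h]] /=; rewrite -!height_trunc -(cocycleE _ _ _ h).
apply: bigcupT_measurable => N; apply: measurableI; first exact: measurable_tail_eq.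
exact: (measurable_trunc2 g N N (fun s t =>
  Q (height (nth [::] t) N - height (nth [::] s) N))).
Qed.

(** Such a map is continuous for the topology of cylinders: the preimage of a cylinder is determined
    by finitely many rows. *)
Lemma measurable_local (g : OmegaM -> OmegaM) :
  (forall M, exists K, forall w w',
     trunc w K = trunc w' K -> trunc (g w) M = trunc (g w') M) ->
  measurable_fun setT g.
Proof.
move=> lg; apply: (@measurability _ _ OmegaM OmegaM setT g cylinders) => //.
move=> _ [_ [a fa <-] <-]; rewrite setTI.
have [K hK] := lg (size a).-1.
have a0 : (0 < size a)%N by case: fa => -[]; case: (a).
have sa : size a = (size a).-1.+1 by rewrite prednK.
rewrite (_ : _ @^-1` _ = [set w | [set t | exists2 w', trunc w' K = t & cyl a (g w')]
    (trunc w K)]); first exact: measurable_trunc.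
apply/seteqP; split=> w /=; first by exists w.
move=> [w' e]; have {}e := hK _ _ e.
by rewrite (cyl_truncE sa) e -(cyl_truncE sa).
Qed.

Lemma measurable_swap_act N la a b : is_sign N la -> paths_to la a -> paths_to la b ->
  measurable_fun setT (swap_act N la a b : OmegaM -> OmegaM).
Proof.
move=> sla pa pb; apply: measurable_local => M; exists (maxn N M) => w w' e.
apply/trunc_eqP => i iM.
have {}e : forall j, (j <= maxn N M)%N -> vert w j = vert w' j by apply/trunc_eqP.
have eN : vert w N = vert w' N by apply: e; exact: leq_maxl.
have ei : vert w i = vert w' i by apply: e; rewrite (leq_trans iM)// leq_maxr.
have [wN|wN] := eqVneq (vert w N) la; last first.
  by rewrite /swap_act /gen_act -eN (negbTE wN).
rewrite !gen_act_vert// -?eN//; try exact: swap_paths_perm.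
rewrite ei; case: ifP => // iN; congr (nth [::] (swap_paths a b _) i).
by apply/trunc_eqP => j jN; apply: e; rewrite (leq_trans jN)// leq_maxl.
Qed.

(** The empty set is added because disjoint cylinders must have their intersection in the family for
    a Dynkin argument. *)
Lemma measurable_genE :
  @measurable _ OmegaM = <<s cylinders `|` [set set0] >>.
Proof.
apply/seteqP; split.
  by apply: sub_sigma_algebra2 => A; left.
apply: smallest_sub; first exact: smallest_sigma_algebra.
move=> A [|->]; first exact: sub_sigma_algebra.
exact: (@measurable0 _ OmegaM).
Qed.

(** A common path [w] determines both cylinders through its initial segments, so the intersection is
    the one with the longer segment. *)
Lemma cylI a c : from_star a -> from_star c ->
  cyl a `&` cyl c = set0 \/
  exists2 w, cyl a w /\ cyl c w & cyl a `&` cyl c = cyl (trunc w (maxn (size a).-1 (size c).-1)).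
Proof.
move=> fa fc.
have sE s : from_star s -> size s = (size s).-1.+1.
  by move=> [[+ _] _]; case: s.
have [->|/set0P[w [wa wc]]] := eqVneq (cyl a `&` cyl c) set0; first by left.
right; exists w => //; apply/seteqP; split=> w'.
  move=> [w'a w'c]; apply/cyl_trunc/trunc_eqP => i.
  rewrite leq_max => /orP[] ia.
    by rewrite w'a ?wa// (sE _ fa) ltnS.
  by rewrite w'c ?wc// (sE _ fc) ltnS.
move=> /cyl_trunc/trunc_eqP h; split=> i ia.
  by rewrite h ?wa// leq_max -ltnS -(sE _ fa) ia.
by rewrite h ?wc// leq_max orbC -ltnS -(sE _ fc) ia.
Qed.

Lemma setI_closed_cyl : setI_closed (cylinders `|` [set set0]).
Proof.
move=> A B [[a fa <-]|->] [[b fb <-]|->]; rewrite ?set0I ?setI0; try by right.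
have [->|[w _ ->]] := cylI a b fa fb; first by right.
by left; exists (trunc w (maxn (size a).-1 (size b).-1)) => //; exact: trunc_from_star.
Qed.

Section Central.
Context {R : realType} (q : R) (P : probability OmegaM R).
Hypotheses (q01 : 0 < q < 1) (qc : q_central q P).

Let q0 : q != 0. Proof. by case/andP: q01 => /lt0r_neq0. Qed.

Lemma fin_numP (A : set OmegaM) : measurable A -> P A \is a fin_num.
Proof. by move=> mA; exact: fin_num_measure. Qed.

(** By centrality, cylinders with the same end have measures proportional to their weights, and the
    terms of the common last row cancel in the quotient. *)
Lemma central_cyl K w w' : vert w K = vert w' K ->
  (P (cyl (trunc w' K)) =
  (q ^ (2 * (height (vert w') K - height (vert w) K)))%:E * P (cyl (trunc w K)))%E.
Proof.
move=> wK.
have e : fine (P (cyl (trunc w K))) / pw q (trunc w K) =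
         fine (P (cyl (trunc w' K))) / pw q (trunc w' K).
  rewrite (qc _ _ _ (vert_sign w K) (trunc_path w K)).
  by rewrite (qc _ _ _ (vert_sign w' K) (trunc_path w' K)) wK.
have mc v : measurable (cyl (trunc v K) : set OmegaM).
  by apply: measurable_cyl; exact: trunc_from_star.
rewrite -[LHS]fineK ?fin_numP// -[X in (_ * X)%E]fineK ?fin_numP// -EFinM.
congr EFin; move: e; rewrite !pw_truncE// -wK.
have pn z : q ^ z != 0 by rewrite expfz_neq0.
move=> /(congr1 (fun x => x * q ^ (2 * height (vert w') K -
   (K%:Z - 1) * sumi (vert w K)))).
rewrite divfK// => <-; rewrite -mulrA mulrC; congr (_ * _).
by rewrite invr_expz -expfzDr//; congr (q ^ _); ring.
Qed.

Section SwapMeasure.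
Variables (N : nat) (la : seq int) (a b : seq (seq int)).
Hypotheses (sla : is_sign N la) (pa : paths_to la a) (pb : paths_to la b).

Let tau := swap_act N la a b : OmegaM -> OmegaM.
Let c : R := q ^ (2 * (height (nth [::] b) N - height (nth [::] a) N)).
Let mtau : measurable_fun setT tau.
Proof. exact: measurable_swap_act. Qed.

Let from_star_paths s : paths_to la s -> from_star s.
Proof. by move=> [? []]. Qed.

Let tau_cyl w : cyl b (tau w) <-> cyl a w.
Proof.
split; last exact: swap_act_cyl.
move=> h; rewrite -(swap_actK _ _ _ _ sla pa pb w) -/(tau w) swap_actC.
exact: swap_act_cyl.
Qed.

Let heightE s w : paths_to la s -> cyl s w -> height (nth [::] s) N = height (vert w) N.
Proof.
move=> ps; rewrite (cyl_truncE (paths_to_size sla ps)) => <-.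
by rewrite height_trunc.
Qed.

Let swap_cyl s : from_star s ->
  (P (cyl b `&` tau @^-1` (cyl s)) = c%:E * P (cyl a `&` cyl s))%E.
Proof.
move=> fs; have fa := from_star_paths _ pa; have fb := from_star_paths _ pb.
have tt w : tau (tau w) = w := swap_actK _ _ _ _ sla pa pb w.
have [e|[w [wa ws] ->]] := cylI a s fa fs.
  rewrite e measure0 mule0 (_ : _ `&` _ = set0) ?measure0//.
  rewrite -subset0 => w' [w'b w's].
  suff : (cyl a `&` cyl s) (tau w') by rewrite e.
  by split=> //; apply/tau_cyl; rewrite tt.
set K := maxn _ _.
have NK : (N <= K)%N by rewrite /K (paths_to_size sla pa) leq_maxl.
have tw : tail_eq N w (tau w) by exact: swap_act_tail.
(* Between the cylinders of [a] and [b], [tau] replaces the first rows and keeps the others, so it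
   carries the cylinder of [w] at level [K] onto that of [tau w]. The height difference at [K] is
   then the one at [N]. *)
rewrite (_ : _ `&` _ = cyl (trunc (tau w) K)); last first.
  have tl := fun v => swap_act_tail N la a b sla pa pb v.
  have bw : cyl b (tau w) by apply/tau_cyl.
  have ltr v v' : cyl a v -> cyl a v' -> trunc v K = trunc v' K <->
    trunc (tau v) K = trunc (tau v') K.
    move=> va v'a; have := proj2 (tau_cyl v) va; have := proj2 (tau_cyl v') v'a.
    move=> /(cyl_truncE (paths_to_size sla pb))/esym h1.
    move=> /(cyl_truncE (paths_to_size sla pb)); rewrite h1.
    move: va => /(cyl_truncE (paths_to_size sla pa)).
    move: v'a => /(cyl_truncE (paths_to_size sla pa))/esym -> h2.
    move/trunc_eqP: h2 => h2 /trunc_eqP h3.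
    split=> /trunc_eqP h; apply/trunc_eqP => i iK; case: (leqP i N) => iN.
    - exact: h3.
    - by rewrite /tau -!tl ?(ltnW iN)//; exact: h.
    - exact: h2.
    - by have := h i iK; rewrite /tau -!tl ?(ltnW iN).
  have aK v : cyl (trunc w K) v <-> cyl a v /\ cyl s v.
    have [e|[u [ua us] e]] := cylI a s fa fs.
      by have : set0 w by rewrite -e.
    have wu : trunc w K = trunc u K by apply/cyl_trunc; rewrite -e.
    by rewrite -[cyl a v /\ _]/((cyl a `&` cyl s) v) e -/K wu.
  apply/seteqP; split=> v.
    move=> [vb vs]; have va : cyl a (tau v) by apply/tau_cyl; rewrite tt.
    apply/cyl_trunc; rewrite -(tt v).
    by apply: (proj1 (ltr _ _ va wa)); apply/cyl_trunc/aK.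
  move=> /cyl_trunc h.
  have vb : cyl b v.
    apply/(cyl_truncE (paths_to_size sla pb)).
    move: bw => /(cyl_truncE (paths_to_size sla pb)) <-.
    apply/trunc_eqP => i iN; move/trunc_eqP: h; apply.
    exact: leq_trans NK.
  have va : cyl a (tau v) by apply/tau_cyl; rewrite tt.
  split=> //=; suff [//] : cyl a (tau v) /\ cyl s (tau v).
  by apply/aK/cyl_trunc; apply: (proj2 (ltr _ _ va wa)); rewrite tt.
rewrite (central_cyl K w (tau w) (tw K NK)).
rewrite (height_tail _ _ _ _ tw NK) -(heightE _ _ pa wa).
by rewrite -(heightE _ (tau w) pb)//; apply/tau_cyl.
Qed.

(** The identity holds on cylinders by [swap_cyl] and extends to all events by Dynkin induction. *)
Lemma swap_measure (E : set OmegaM) : measurable E ->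
  (P (cyl b `&` tau @^-1` E) = c%:E * P (cyl a `&` E))%E.
Proof.
have mE := measurable_genE; move=> mE'.
have ma : measurable (cyl a : set OmegaM) := measurable_cyl _ (from_star_paths _ pa).
have mb : measurable (cyl b : set OmegaM) := measurable_cyl _ (from_star_paths _ pb).
have mt (S : set OmegaM) : measurable S -> measurable (tau @^-1` S).
  by move=> mS; rewrite -[X in measurable X]setTI; exact: mtau.
(* The whole space is the cylinder of the trivial path; this instance is used for complements. *)
have swT : (P (cyl b `&` tau @^-1` setT) = c%:E * P (cyl a `&` setT))%E.
  have f0 : from_star [:: [::]].
    split=> //; split=> //; split=> -[|i]//= _; split=> //.
  rewrite (_ : setT = cyl [:: [::]]) ?swap_cyl//.
  by apply/seteqP; split=> // w _ [|i]//= _; rewrite vert0.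
apply: (dynkin_induction mE setI_closed_cyl (P := fun E : set OmegaM =>
  (P (cyl b `&` tau @^-1` E) = c%:E * P (cyl a `&` E))%E)) => //.
- move=> _ [[s fs <-]|->]; first exact: swap_cyl.
  by rewrite preimage_set0 !setI0 !measure0 mule0.
- move=> S mS h; rewrite preimage_setC.
  have DE (A B : set OmegaM) : measurable A -> measurable B ->
      (P (A `&` ~` B) = P A - P (A `&` B))%E.
    by move=> mA mB; rewrite -setDE measureD// ltey_eq fin_numP.
  rewrite (DE _ _ ma mS) (DE _ _ mb (mt _ mS)) h muleBr//; last first.
    by rewrite fin_num_adde_defr// fin_numP//; exact: measurableI.
  by congr (_ - _)%E; move: swT; rewrite preimage_setT !setIT.
- move=> F mF tF h; rewrite preimage_bigcup !setI_bigcupr.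
  rewrite !measure_bigcup.
  + rewrite -nneseriesZl//; apply: eq_eseriesr => i _; exact: h.
  + by move=> i _; apply: measurableI.
  + exact: trivIset_setIl.
  + by move=> i _; apply: measurableI => //; exact: mt.
  + by move=> i j _ _ [w [[_ wi] [_ wj]]]; apply: tF => //; exists (tau w).
- by rewrite -mE.
Qed.

(** On [E] the initial segment of [g w] and its tail are both prescribed, so [g] coincides there
    with the exchange [tau]. *)
Lemma measure_image_swap (g : OmegaM -> OmegaM) (E : set OmegaM) : measurable E ->
  (forall w, E w -> [/\ cyl a w, cyl b (g w) & tail_eq N w (g w)]) ->
  P (g @` E) = (c%:E * P E)%E.
Proof.
move=> mE hE.
have tt w : tau (tau w) = w := swap_actK _ _ _ _ sla pa pb w.
have gE w : E w -> g w = tau w.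
  move=> /hE[wa gb gt]; apply: vert_inj => n; case: (leqP n N) => nN; last first.
    by rewrite -gt ?(ltnW nN)// -swap_act_tail// ltnW.
  have sb := paths_to_size sla pb.
  have : trunc (g w) N = trunc (tau w) N.
    transitivity b; first exact/(cyl_truncE sb).
    by apply/esym/(cyl_truncE sb)/tau_cyl.
  by move=> /trunc_eqP; apply.
rewrite -[in RHS](_ : cyl a `&` E = E); last first.
  by apply/seteqP; split=> [w []//|w Ew]; split=> //; have [] := hE w Ew.
rewrite -swap_measure//; congr (P _); apply/seteqP; split=> w.
  by move=> [w' Ew' <-]; rewrite gE//; split; [apply/tau_cyl; have [] := hE _ Ew'|rewrite /= tt].
by move=> [wb Ew]; exists (tau w) => //; rewrite gE// tt.
Qed.
End SwapMeasure.

End Central.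

(** * Radon-Nikodym derivatives of the full group *)

Lemma countable_cover_pos (R : realType) (P : probability OmegaM R) (I : countType)
    (F : I -> set OmegaM) (B : set OmegaM) :
  (forall i, measurable (F i)) -> measurable B -> B `<=` \bigcup_i F i ->
  (0 < P B)%E -> exists i, (0 < P (B `&` F i))%E.
Proof.
move=> mF mB BF PB; apply: contrapT => /forallNP h.
have P0 i : P (B `&` F i) = 0%E.
  by apply/eqP; rewrite eq_le measure_ge0 andbT leNgt; apply/negP; exact: h.
suff : P.-negligible B by move/(negligibleP P mB) => e; rewrite e ltxx in PB.
apply: (@negligibleS _ _ _ P (\bigcup_n (if unpickle n is Some i then B `&` F i else set0))).
  move=> w Bw; have [i _ Fi] := BF w Bw.
  by exists (pickle i) => //; rewrite pickleK.
apply: negligible_bigcup => n; case: unpickle => [i|]; last exact: negligible_set0.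
by apply/negligibleP; [exact: measurableI|exact: P0].
Qed.

Section RN.
Context {R : realType} (q : R) (P : probability OmegaM R).
Hypotheses (q01 : 0 < q < 1) (qc : q_central q P).

Lemma full_group_RN (g : OmegaM -> OmegaM) : full_group g ->
  is_RN_deriv P g (fun w => (q ^ (2 * cocycle w (g w)))%:E).
Proof.
move=> /full_groupP[mg [h [mh gh hg]] gt].
have [q0 _] := andP q01.
have mf : measurable_fun setT (fun w : OmegaM => (q ^ (2 * cocycle w (g w)))%:E).
  move=> _ Y mY; rewrite setTI.
  exact: (measurable_cocycle g [set k | Y (q ^ (2 * k))%:E]).
split=> //; split; first by move=> w; rewrite lee_fin exprz_ge0// ltW.
move=> A mA.
(* [D] runs over the countably many triples of a level, an old and a new initial segment. Made
   disjoint, these sets cut [A] into pieces on which [g] is one exchange. *)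
pose D i : set OmegaM := if unpickle i is Some (N, a, b)
  then [set w | (trunc w N = a /\ trunc (g w) N = b) /\ tail_eq N w (g w)] else set0.
have mD i : measurable (D i).
  rewrite /D; case: unpickle => [[[N a] b]|]; last exact: measurable0.
  apply: measurableI; last exact: measurable_tail_eq.
  exact: (measurable_trunc2 g N N (fun s t => s = a /\ t = b)).
have UD : \bigcup_i seqDU D i = setT.
  rewrite -seqDU_bigcup_eq; apply/seteqP; split=> // w _.
  have [N hN] := gt w.
  by exists (pickle (N, trunc w N, trunc (g w) N)) => //; rewrite /D pickleK.
have mE i : measurable (A `&` seqDU D i) by apply: measurableI => //; exact: seqDU_measurable.
have tE : trivIset setT (fun i => A `&` seqDU D i).
  by apply: trivIset_setIl; exact: trivIset_seqDU.
have imE (S : set OmegaM) : g @` S = h @^-1` S.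
  apply/seteqP; split=> w; first by move=> [v Sv <-]; rewrite /= gh.
  by move=> Sw; exists (h w).
have mh' (S : set OmegaM) : measurable S -> measurable (h @^-1` S).
  by move=> mS; rewrite -[X in measurable X]setTI; exact: mh.
have piece i : P (g @` (A `&` seqDU D i)) =
    (\int[P]_(w in A `&` seqDU D i) (q ^ (2 * cocycle w (g w)))%:E)%E.
  have [e|/set0P[w0 [Aw0 Uw0]]] := eqVneq (A `&` seqDU D i) set0.
    by rewrite e image_set0 measure0 integral_set0.
  have := @subset_seqDU _ D i w0 Uw0; rewrite /D; case ei : unpickle => [[[N a] b]|]//= [[w0a w0b] w0t].
  have sub w : (A `&` seqDU D i) w -> [/\ cyl a w, cyl b (g w) & tail_eq N w (g w)].
    move=> [_ Uw]; have := @subset_seqDU _ D i w Uw; rewrite /D ei => -[[<- <-] t].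
    by split=> //; exact/cyl_trunc.
  rewrite (measure_image_swap q P q01 qc N (vert w0 N) a b)//.
  - rewrite -integral_cst//; apply: eq_integral => w; rewrite inE => /[dup] -[_ _].
    move=> /sub[wa wb t] /=.
    rewrite (cocycleE N)// !height_trunc.
    by have /esym -> := proj1 (cyl_truncE (etrans (congr1 size (esym w0a)) (size_trunc _ _))) wa;
       have /esym -> := proj1 (cyl_truncE (etrans (congr1 size (esym w0b)) (size_trunc _ _))) wb.
  - exact: vert_sign.
  - by rewrite -w0a; exact: trunc_path.
  - by rewrite -w0b w0t//; exact: trunc_path.
have AE : A = \bigcup_i (A `&` seqDU D i) by rewrite -setI_bigcupr UD setIT.
rewrite [in RHS]AE ge0_integral_bigcup//; last 2 first.
- by rewrite -AE; exact: measurable_funTS.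
- by move=> w _; rewrite lee_fin exprz_ge0// ltW.
rewrite {1}AE imE preimage_bigcup measure_semi_bigcup.
- by apply: eq_eseriesr => i _; rewrite -piece imE.
- by move=> i; exact: mh'.
- by move=> i j _ _ [w [wi wj]]; apply: tE => //; exists (h w).
- by apply: bigcupT_measurable => i; exact: mh'.
Qed.

Lemma full_group_image (g : OmegaM -> OmegaM) (B : set OmegaM) (k : int) :
  full_group g -> measurable B -> (forall w, B w -> cocycle w (g w) = k) ->
  P (g @` B) = ((q ^ (2 * k))%:E * P B)%E.
Proof.
move=> fg mB Bk; have [_ [_ ->//]] := full_group_RN g fg.
rewrite -integral_cst//; apply: eq_integral => w; rewrite inE => Bw.
by rewrite Bk.
Qed.

(** The cocycle has countably many values, so it is a constant [k] on some part [E] of [B] with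
    positive measure. There the integral of [f] equals [q ^ (2 * k)] times [P E], and it is within
    [eps] times [P E] of [r] times [P E]. *)
Lemma ratio_set_approx (r eps : R) : ratio_set P r -> 0 < eps ->
  exists k : int, `|q ^ (2 * k) - r| <= eps.
Proof.
move=> [r0 hr] e0; have [q0 _] := andP q01.
have [|B [g [[mB fg PB _ _] [f [[mf [f0 fE]] fr]]]]] := hr eps e0 setT (@measurableT _ OmegaM).
  by rewrite probability_setT lte01.
have [mg _ gt] := proj1 (full_groupP g) fg.
pose F k : set OmegaM := [set w | cocycle w (g w) = k].
have mF k : measurable (F k) by exact: (measurable_cocycle g [set l | l = k]).
have [|k PE] := countable_cover_pos R P _ F B mF mB _ PB.
  by move=> w _; exists (cocycle w (g w)).
set E := B `&` F k in PE; exists k.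
have mE : measurable E by exact: measurableI.
have := full_group_image g E k fg mE (fun w Ew => proj2 Ew); rewrite fE// => fI.
have PEf := fin_numP P E mE.
have fb : {ae P, forall w, E w -> ((r - eps)%:E <= f w <= (r + eps)%:E)%E}.
  apply: filterS fr => w + [Bw _] => /(_ Bw).
  case: (f w) => [x| |]//=; rewrite lte_fin ltr_norml !lee_fin => /andP[h1 h2].
  by apply/andP; split; lra.
rewrite ler_distl; apply/andP; split.
  have [le0|gt0] := lerP (r - eps) 0.
    by rewrite (le_trans le0)// exprz_ge0// ltW.
  have : (\int[P]_(w in E) (r - eps)%:E <= \int[P]_(w in E) f w)%E.
    apply: ae_ge0_le_integral => //.
    - by move=> w _; rewrite lee_fin ltW.
    - exact: measurable_funTS.
    - by apply: filterS fb => w + Ew => /(_ Ew) /andP[].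
  by rewrite fI integral_cst// lee_pmul2r// lee_fin.
have : (\int[P]_(w in E) f w <= \int[P]_(w in E) (r + eps)%:E)%E.
  apply: ae_ge0_le_integral => //.
  - exact: measurable_funTS.
  - by move=> w _; rewrite lee_fin addr_ge0// ltW.
  - by apply: filterS fb => w + Ew => /(_ Ew) /andP[].
by rewrite fI integral_cst// lee_pmul2r// lee_fin.
Qed.

Lemma ratio_set_sub :
  ratio_set P `<=` [set 0] `|` [set q ^ (2 * n) | n in [set: int]].
Proof.
move=> r rr; have [r0 _] := rr; have [q0 q1] := andP q01.
have [->|rn0] := eqVneq r 0; [by left|right].
have {rn0 r0} r0 : 0 < r by rewrite lt_neqAle eq_sym rn0.
have p1 : q ^ 2%:Z < 1 by rewrite -exprnP exprn_ilt1// ltW.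
have p0 : 0 < q ^ 2%:Z by rewrite exprz_gt0.
set p := q ^ 2%:Z in p1 p0.
have pE k : q ^ (2 * k) = p ^ k by rewrite /p exprz_exp.
(* This margin gives [p * (r + d) < r - d], so at most one power of [p] is within [d] of [r]. *)
pose d := r * (1 - p) / 4.
have d0 : 0 < d by rewrite /d divr_gt0// mulr_gt0// subr_gt0.
have [k hk] := ratio_set_approx r d rr d0.
exists k => //; apply/eqP; apply: contrapT => /negP nrk.
(* An accuracy finer than the distance from [q ^ (2 * k)] to [r] forces a second power, also within
   [d]. *)
have e0 : 0 < Num.min d (`|q ^ (2 * k) - r| / 2).
  by rewrite lt_min d0 divr_gt0// normr_gt0 subr_eq0.
have [l hl] := ratio_set_approx r _ rr e0.
have kl : k != l.
  apply: contraTneq hl => <-; rewrite -ltNge gt_min; apply/orP; right.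
  by rewrite ltr_pdivrMr// ltr_pMr ?ltr1n// normr_gt0 subr_eq0.
have {}hl : `|q ^ (2 * l) - r| <= d.
  by apply: (le_trans hl); rewrite ge_min lexx.
have step (i j : int) : i < j -> `|q ^ (2 * i) - r| <= d -> `|q ^ (2 * j) - r| <= d -> False.
  move=> ij; rewrite !ler_distl !pE => /andP[_ h1] /andP[h2 _].
  have h3 : p ^ j <= p * p ^ i.
    have [n ->] : exists n : nat, j = n%:Z + (1 + i).
      by case e : (j - i - 1) => [n|n]; [exists n|exfalso]; lia.
    rewrite expfzDr ?gt_eqF// expfzDr ?gt_eqF// expr1z ler_piMl//.
      by rewrite mulr_ge0// ?exprz_ge0// ltW.
    by rewrite -exprnP exprn_ile1// ltW.
  have h4 : p * p ^ i <= p * (r + d) by rewrite ler_pM2l.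
  have : r - d <= p * (r + d) by lra.
  rewrite /d -subr_ge0; apply/negP; rewrite -ltNge.
  have -> : p * (r + r * (1 - p) / 4) - (r - r * (1 - p) / 4) =
     - (r * (1 - p) * (3 - p) / 4) by field.
  rewrite oppr_lt0 divr_gt0// mulr_gt0 ?mulr_gt0 ?subr_gt0//.
  by rewrite (lt_trans p1)// ltr1n.
case: (ltgtP k l) => [h|h|h]; [exact: step h hk hl|exact: step h hl hk|].
by rewrite h eqxx in kl.
Qed.

(* The property of [r = q ^ (2 * k)] witnessing that it lies in the ratio set
   with [eps = 0]; unlike the ratio set, it composes and inverts directly. *)
Definition exact_ratio (k : int) := forall A : set OmegaM, measurable A -> (0 < P A)%E ->
  exists (B : set OmegaM) (g : OmegaM -> OmegaM),
    [/\ measurable B, full_group g, (0 < P B)%E, B `<=` A & g @` B `<=` A] /\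
    forall w, B w -> cocycle w (g w) = k.

(** * The exact ratios form a group *)

Lemma measurable_image (g : OmegaM -> OmegaM) (A : set OmegaM) :
  full_group g -> measurable A -> measurable (g @` A).
Proof.
move=> /full_groupP[_ [h [mh gh hg]] _] mA.
rewrite (_ : g @` A = setT `&` h @^-1` A); first exact: mh.
rewrite setTI; apply/seteqP; split=> w; first by move=> [v Av <-]; rewrite /= gh.
by move=> Aw; exists (h w).
Qed.

Lemma image_pos (g : OmegaM -> OmegaM) (B : set OmegaM) (k : int) :
  full_group g -> measurable B -> (forall w, B w -> cocycle w (g w) = k) ->
  (0 < P B)%E -> (0 < P (g @` B))%E.
Proof.
move=> fg mB Bk PB; rewrite (full_group_image g B k fg mB Bk).
by rewrite mule_gt0// lte_fin exprz_gt0//; case/andP: q01.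
Qed.

(** The second map is sought inside the image of [B] under [g], which still has positive measure;
    its domain [C] is pulled back by the inverse of [g], and the cocycles add. *)
Lemma exact_ratioD k l : exact_ratio k -> exact_ratio l -> exact_ratio (k + l).
Proof.
move=> hk hl A mA PA.
have [B [g [[mB fg PB BA gBA] gk]]] := hk A mA PA.
have [C [h [[mC fh PC CB hCB] hl']]] :=
  hl (g @` B) (measurable_image _ _ fg mB) (image_pos _ _ _ fg mB gk PB).
have [mg [g' [mg' gg' g'g]] gt] := proj1 (full_groupP g) fg.
have [mh [h' [mh' hh' h'h]] ht] := proj1 (full_groupP h) fh.
have fg' : full_group g'.
  apply/full_groupP; split=> //; first by exists g.
  by move=> w; have [N hN] := gt (g' w); exists N; rewrite g'g in hN; exact: tail_eq_sym.
have fgh : full_group (h \o g).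
  apply/full_groupP; split.
  - exact: measurableT_comp.
  - exists (g' \o h'); split; first exact: measurableT_comp.
      by move=> w /=; rewrite hh' gg'.
    by move=> w /=; rewrite g'g h'h.
  - move=> w; have [N hN] := gt w; have [M hM] := ht (g w); exists (maxn N M).
    apply: (tail_eq_trans _ _ (g w)); first by apply: tail_eq_le hN; rewrite leq_maxl.
    by apply: tail_eq_le hM; rewrite leq_maxr.
have sub : g' @` C `<=` B by move=> _ [w /CB[v Bv <-] <-]; rewrite gg'.
exists (g' @` C), (h \o g); split; first split=> //.
- exact: measurable_image.
- apply: (image_pos _ _ (- k)) => // w Cw.
  have [v Bv e] := CB w Cw; have [N hN] := gt v.
  rewrite -e gg' (cocycleE N); last exact: tail_eq_sym.
  by have := gk v Bv; rewrite (cocycleE N)//; lia.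
- by move=> w /sub/BA.
- move=> _ [_ [w Cw <-] <-] /=; rewrite g'g.
  have [v Bv <-] := hCB _ (imageP h Cw); apply: gBA; exact: imageP.
move=> _ [w Cw <-] /=.
have [N hN] := gt (g' w); have [M hM] := ht (g (g' w)).
rewrite (cocycle_trans (maxn N M) _ (g (g' w))).
- rewrite gk; last exact/sub/imageP.
  by rewrite g'g hl'.
- by apply: tail_eq_le hN; rewrite leq_maxl.
- by apply: tail_eq_le hM; rewrite leq_maxr.
Qed.

Lemma exact_ratioN k : exact_ratio k -> exact_ratio (- k).
Proof.
move=> hk A mA PA.
have [B [g [[mB fg PB BA gBA] gk]]] := hk A mA PA.
have [mg [g' [mg' gg' g'g]] gt] := proj1 (full_groupP g) fg.
have fg' : full_group g'.
  apply/full_groupP; split=> //; first by exists g.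
  by move=> w; have [N hN] := gt (g' w); exists N; rewrite g'g in hN; exact: tail_eq_sym.
exists (g @` B), g'; split; first split=> //.
- exact: measurable_image.
- exact: image_pos gk PB.
- by move=> _ [_ [w Bw <-] <-]; rewrite gg'; exact: BA.
move=> _ [w Bw <-]; rewrite gg'; have [N hN] := gt w.
have := gk w Bw; rewrite (cocycleE N)// (cocycleE N); last exact: tail_eq_sym.
by lia.
Qed.

Lemma exact_ratio_nat : exact_ratio 1 -> forall n : nat, exact_ratio n.+1%:Z.
Proof.
move=> h1; elim=> [//|n IH].
have -> : n.+2%:Z = n.+1%:Z + 1 by lia.
exact: exact_ratioD.
Qed.

Lemma exact_ratio_int : exact_ratio 1 -> forall k, exact_ratio k.
Proof.
move=> h1 [[|n]|n].
- have -> : Posz 0 = 1 + (-1) by lia.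
  by apply: exact_ratioD => //; exact: exact_ratioN.
- exact: exact_ratio_nat.
- by rewrite NegzE; apply/exact_ratioN/exact_ratio_nat.
Qed.

Lemma exact_ratio_in (k : int) (r : R) : exact_ratio k -> 0 <= r ->
  forall eps : R, `|q ^ (2 * k) - r| < eps ->
  forall A : set OmegaM, measurable A -> (0 < P A)%E ->
  exists (B : set OmegaM) (g : OmegaM -> OmegaM),
    [/\ measurable B, full_group g, (0 < P B)%E, B `<=` A & g @` B `<=` A] /\
    exists f, is_RN_deriv P g f /\
      {ae P, forall w, B w -> (`| f w - r%:E | < eps%:E)%E}.
Proof.
move=> hk r0 eps he A mA PA; have [B [g [h gk]]] := hk A mA PA.
exists B, g; split=> //; have [_ fg _ _ _] := h.
exists (fun w => (q ^ (2 * cocycle w (g w)))%:E); split; first exact: full_group_RN.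
by apply: aeW => w Bw; rewrite gk// -EFinB abse_EFin lte_fin.
Qed.

Lemma ratio_setE : exact_ratio 1 ->
  ratio_set P = [set 0] `|` [set q ^ (2 * n) | n in [set: int]].
Proof.
move=> h1; apply/seteqP; split; first exact: ratio_set_sub.
have [q0 q1] := andP q01.
move=> _ [->|[k _ <-]]; split=> //.
(* The ratio 0 is reached as the limit of the exact ratios [q ^ (2 * n)]. *)
- move=> eps e0.
  have /cvgrPdist_lt/(_ eps e0)[n _ /(_ n (leqnn n))] :
     (fun n : nat => (q ^+ 2) ^+ n) @ \oo --> (0 : R).
    by apply: cvg_expr; rewrite ger0_norm ?exprn_ge0 ?exprn_ilt1// ltW.
  rewrite /= sub0r normrN => hn.
  apply: (exact_ratio_in n%:Z) => //; first exact: exact_ratio_int.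
  by rewrite subr0 mulrC -PoszM -exprnP mulnC exprM.
- by rewrite exprz_ge0// ltW.
- move=> eps e0; apply: (exact_ratio_in k); first exact: exact_ratio_int.
    by rewrite exprz_ge0// ltW.
  by rewrite subrr normr0.
Qed.
End RN.

(** * Approximation by events depending on finitely many rows *)

Definition saturated (N : nat) (F : set OmegaM) : Prop :=
  forall w w', trunc w N = trunc w' N -> F w -> F w'.

Lemma saturated_le N M F : (N <= M)%N -> saturated N F -> saturated M F.
Proof.
move=> NM h w w' /trunc_eqP e; apply: h; apply/trunc_eqP => i iN; apply: e.
exact: leq_trans NM.
Qed.

Lemma saturatedU N F G : saturated N F -> saturated N G -> saturated N (F `|` G).
Proof. by move=> hF hG w w' e [/hF|/hG]; [left|right]; eauto. Qed.

Lemma saturatedC N F : saturated N F -> saturated N (~` F).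
Proof. by move=> hF w w' e nF /hF Fw; apply: nF; exact: Fw. Qed.

Lemma measurable_saturated N F : saturated N F -> measurable F.
Proof.
move=> sF; rewrite (_ : F = [set w | [set t | exists2 w', trunc w' N = t & F w'] (trunc w N)]).
  exact: measurable_trunc.
by apply/seteqP; split=> w; [exists w|move=> [w' /sF]; exact].
Qed.

Section Approx.
Context {R : realType} (P : probability OmegaM R).

Definition pr (A : set OmegaM) : R := fine (P A).

Lemma prE A : measurable A -> P A = (pr A)%:E.
Proof. by move=> mA; rewrite fineK// fin_numP. Qed.

Lemma pr_ge0 A : 0 <= pr A.
Proof. by rewrite fine_ge0. Qed.

Lemma pr_le A B : measurable A -> measurable B -> A `<=` B -> pr A <= pr B.
Proof.
by move=> mA mB AB; rewrite -lee_fin -!prE// le_measure// inE.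
Qed.

Lemma prU A B : measurable A -> measurable B -> pr (A `|` B) <= pr A + pr B.
Proof.
move=> mA mB; rewrite -lee_fin EFinD -!prE//; last exact: measurableU.
exact: measureU2.
Qed.

Lemma prUD A B C : measurable A -> measurable B -> measurable C ->
  C `<=` A `|` B -> pr C <= pr A + pr B.
Proof.
by move=> mA mB mC CAB; rewrite (le_trans _ (prU _ _ mA mB))// pr_le//; exact: measurableU.
Qed.

Lemma pr_gt0 A : measurable A -> (0 < P A)%E = (0 < pr A).
Proof. by move=> mA; rewrite prE// lte_fin. Qed.

Definition approximable (A : set OmegaM) := measurable A /\
  forall eps : R, 0 < eps -> exists N F, [/\ saturated N F,
     pr (A `\` F) < eps & pr (F `\` A) < eps].

Lemma approximableC A : approximable A -> approximable (~` A).
Proof.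
move=> [mA hA]; split=> [|eps e0]; first exact: measurableC.
have [N [F [sF h1 h2]]] := hA eps e0; exists N, (~` F).
by rewrite !setDE !setCK setIC -setDE (setIC (~` F)) -setDE; split=> //; exact: saturatedC.
Qed.

Lemma approximableU A B : approximable A -> approximable B -> approximable (A `|` B).
Proof.
move=> [mA hA] [mB hB]; split=> [|eps e0]; first exact: measurableU.
have e2 : 0 < eps / 2 by rewrite divr_gt0.
have [N [F [sF h1 h2]]] := hA _ e2; have [M [G [sG h3 h4]]] := hB _ e2.
have mF := measurable_saturated _ _ sF; have mG := measurable_saturated _ _ sG.
have [mAF mFA] := (measurableD mA mF, measurableD mF mA).
have [mBG mGB] := (measurableD mB mG, measurableD mG mB).
exists (maxn N M), (F `|` G); split.
- apply: saturatedU; first by apply: saturated_le sF; rewrite leq_maxl.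
  by apply: saturated_le sG; rewrite leq_maxr.
- rewrite (@le_lt_trans _ _ (pr (A `\` F) + pr (B `\` G)))//; last by lra.
  apply: prUD => //; first by apply: measurableD; exact: measurableU.
  by move=> w [[?|?] nFG]; [left|right]; split=> // ?; apply: nFG; [left|right].
- rewrite (@le_lt_trans _ _ (pr (F `\` A) + pr (G `\` B)))//; last by lra.
  apply: prUD => //; first by apply: measurableD; exact: measurableU.
  by move=> w [[?|?] nFG]; [left|right]; split=> // ?; apply: nFG; [left|right].
Qed.

Lemma approximable_bigcup (A : (set OmegaM)^nat) :
  (forall n, approximable (A n)) -> approximable (\bigcup_n A n).
Proof.
move=> hA; have mA n : measurable (A n) by have [] := hA n.
have mU : measurable (\bigcup_n A n) by exact: bigcupT_measurable.
split=> // eps e0; have e2 : 0 < eps / 2 by rewrite divr_gt0.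
pose U n := \big[setU/set0]_(i < n) A i.
have aU n : approximable (U n).
  rewrite /U; elim: n => [|n IH]; last by rewrite big_ord_recr; exact: approximableU.
  rewrite big_ord0; split=> // e e0'; exists 0%N, set0.
  by rewrite setD0 /pr measure0; split=> // w w' _.
have mUn n : measurable (U n) by have [] := aU n.
(* Continuity from above: finitely many of the sets exhaust the union up to [eps / 2]. *)
have [n hn] : exists n, pr ((\bigcup_n A n) `\` U n) < eps / 2.
  have cv : P (\bigcup_n A n `\` U n) @[n --> \oo] --> P (\bigcap_n (\bigcup_n A n `\` U n)).
    apply: nonincreasing_cvg_mu.
    - by rewrite ltey_eq fin_numP//; exact: measurableD.
    - by move=> n; exact: measurableD.
    - by apply: bigcapT_measurable => n; exact: measurableD.
    - move=> n m nm; apply/subsetPset => w [Aw nU]; split=> // Uw; apply: nU.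
      rewrite /U -!(bigcup_mkord _ A) in Uw *.
      by case: Uw => i /= im Ai; exists i => //=; exact: leq_trans im nm.
  have e : \bigcap_n (\bigcup_n A n `\` U n) = set0.
    rewrite -subset0 => w h; have [[i _ Ai] _] := h 0%N I.
    have [_] := h i.+1 I; apply; rewrite /U -(bigcup_mkord _ A).
    by exists i => //=.
  rewrite e measure0 in cv.
  have /fine_cvgP[_] : P (\bigcup_n A n `\` U n) @[n --> \oo] --> (0 : R)%:E by [].
  move=> /cvgrPdist_lt/(_ _ e2)[n _ /(_ n (leqnn n))] /=.
  by rewrite sub0r normrN ger0_norm ?pr_ge0 // => h; exists n.
have [_ /(_ _ e2)[N [F [sF h1 h2]]]] := aU n.
have mF := measurable_saturated _ _ sF.
exists N, F; split=> //.
- rewrite (@le_lt_trans _ _ (pr ((\bigcup_n A n) `\` U n) + pr (U n `\` F)))//; last by lra.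
  apply: prUD; [exact: measurableD|exact: measurableD|exact: measurableD|].
  move=> w [Aw nF]; have [Uw|nU] := pselect (U n w); [right|left]; split=> //.
- rewrite (@le_lt_trans _ _ (pr (F `\` U n)))//; last by lra.
  apply: pr_le; [exact: measurableD|exact: measurableD|].
  move=> w [Fw nA]; split=> // Uw; apply: nA.
  by move: Uw; rewrite /U -(bigcup_mkord _ A) => -[i _ Ai]; exists i.
Qed.

(** The approximable events form a sigma-algebra that contains the cylinders. *)
Lemma measurable_approximable A : measurable A -> approximable A.
Proof.
apply: smallest_sub; last first.
  move=> _ [a fa <-]; split; first exact: measurable_cyl.
  move=> eps e0; exists (size a).-1, (cyl a).
  rewrite setDv /pr measure0; split=> // w w' /trunc_eqP e aw i ia.
  have a0 : (0 < size a)%N by exact: leq_ltn_trans ia.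
  by rewrite -e ?aw// -ltnS prednK.
split; last exact: approximable_bigcup.
- split; first exact: measurable0.
  by move=> eps e0; exists 0%N, set0; rewrite setD0 /pr measure0; split=> // w w' _.
- by move=> B hB; rewrite setTD; exact: approximableC.
Qed.
End Approx.

(** * Moving the largest entry of a row *)

Definition top (w : Omega) (n : nat) : int := nth 0 (vert w n) 0.

Definition second (w : Omega) (n : nat) : int := nth 0 (vert w n) 1.

(* [off w n] is the distance from the largest entry of row [n] to the least
   value that rows [n - 1] and [n + 1] allow for it; [top w n.+1] is the
   greatest such value. *)
Definition off (w : Omega) (n : nat) : int :=
  top w n - Num.max (second w n.+1) (top w n.-1).

(** Offsets are paired as 0 with 1, 2 with 3, and so on. An odd offset can always be lowered; an
    even one is matched only if there is room to raise the entry. *)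
Definition active (w : Omega) (n : nat) : bool :=
  odd (absz (off w n)) || (top w n < top w n.+1).

(** Whether a level is active depends on its row and the two adjacent ones. Testing only levels at
    odd distance from [N] ensures that moving an entry of one tested row leaves the other tests
    unchanged. *)
Definition first_active (N : nat) (w : Omega) (n : nat) : Prop :=
  [/\ (N < n)%N, odd (n - N), active w n &
      forall m, (N < m < n)%N -> odd (m - N) -> ~~ active w m].

Definition move_top (w : Omega) (n : nat) : int := if odd (absz (off w n)) then -1 else 1.

Definition flip_raw (N : nat) (w : Omega) (n : nat) : seq int :=
  if `[< first_active N w n >] then (top w n + move_top w n) :: behead (vert w n)
  else vert w n.

Definition flip (N : nat) (w : Omega) : Omega :=
  if pselect (is_ipath (flip_raw N w)) is left p then exist _ _ p else w.

Lemma first_active_uniq N w n m : first_active N w n -> first_active N w m -> n = m.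
Proof.
move=> [Nn on an hn] [Nm om am hm]; case: (ltngtP n m) => // nm.
  by have := hm n; rewrite Nn nm an => /(_ isT on).
by have := hn m; rewrite Nm nm am => /(_ isT om).
Qed.

Lemma first_activeS N w n : first_active N w n -> ~ first_active N w n.+1.
Proof. by move=> h /(first_active_uniq _ _ _ _ h) /eqP; rewrite eqn_leq ltnn andbF. Qed.

Lemma active_exists N w n : (N < n)%N -> odd (n - N) -> active w n ->
  exists m, first_active N w m.
Proof.
move=> Nn on an; have ex : exists m, [&& (N < m)%N, odd (m - N) & active w m].
  by exists n; rewrite Nn on.
case: (ex_minnP ex) => m /and3P[Nm om am] hm; exists m; split=> // k /andP[Nk km] ok.
by apply/negP => ak; have := hm k; rewrite Nk ok ak => /(_ isT); rewrite leqNgt km.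
Qed.

Lemma interlaceP (w : Omega) n i : (i < n)%N ->
  nth 0 (vert w n.+1) i.+1 <= nth 0 (vert w n) i <= nth 0 (vert w n.+1) i.
Proof. by move=> i_n; have [_] := vert_interlace w n; rewrite size_vert; exact. Qed.

Lemma off_ge0 w n : (1 < n)%N -> 0 <= off w n.
Proof.
case: n => [|[|n]] // _; rewrite subr_ge0 ge_max.
have /andP[h1 _] := interlaceP w n.+2 0 isT.
have /andP[_ h2] := interlaceP w n.+1 0 isT.
by apply/andP; split.
Qed.

Lemma odd_absz (x : int) : 0 <= x -> odd (absz x) -> 1 <= x.
Proof. by case: x => [[|x]|]. Qed.

(** With [0 < N] the level [n] is at least 2, so [top w n.-1] is an entry of a nonempty row and not
    the default 0. *)
Lemma move_top_bounds N w n : (0 < N)%N -> first_active N w n ->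
  [/\ second w n.+1 <= top w n + move_top w n,
      top w n.-1 <= top w n + move_top w n &
      top w n + move_top w n <= top w n.+1].
Proof.
move=> N0 [Nn on an _]; have n1 : (1 < n)%N by exact: leq_ltn_trans N0 Nn.
have := off_ge0 w n n1; have oo := odd_absz (off w n).
have h : top w n <= top w n.+1.
  by have /andP[] := interlaceP w n 0 (ltnW n1).
move: an oo; rewrite /active /move_top.
have : (second w n.+1 <= Num.max (second w n.+1) (top w n.-1)) &&
  (top w n.-1 <= Num.max (second w n.+1) (top w n.-1)).
  by rewrite !le_max !lexx orbT.
rewrite /off; move: (Num.max _ _ : int) => mx /andP[h1 h2].
case: (odd _) => /= an oo o0; last by split; lia.
by have := oo o0 isT; split; lia.
Qed.

Lemma flip_raw_ipath N w : (0 < N)%N -> is_ipath (flip_raw N w).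
Proof.
move=> N0 n.
have row k : (0 < k)%N -> vert w k = top w k :: behead (vert w k).
  by rewrite /top; case: (vert w k) (size_vert w k) => //= <-.
have nthf k i : nth 0 (flip_raw N w k) i =
    if `[< first_active N w k >] && (i == 0%N) then top w k + move_top w k else nth 0 (vert w k) i.
  rewrite /flip_raw; case: asboolP => //= fk; case: i => //= i.
  by rewrite nth_behead.
have szf k : size (flip_raw N w k) = k.
  rewrite /flip_raw; case: asboolP => [[Nk _ _ _]|_]; last exact: size_vert.
  by rewrite /= size_behead size_vert prednK// (leq_ltn_trans _ Nk).
split; split.
- exact: szf.
- have [_ sv] := vert_sign w n.
  rewrite /flip_raw; case: asboolP => [fn|//].
  have [b1 b2 b3] := move_top_bounds N w n N0 fn.
  have n1 : (1 < n)%N by case: fn => Nn _ _ _; exact: leq_ltn_trans N0 Nn.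
  rewrite row// in sv; last exact: ltnW.
  case eb : (behead (vert w n)) sv => [|x s]//= /andP[_ ->]; rewrite andbT.
  have -> : x = nth 0 (vert w n) 1 by rewrite (row n)/= ?eb// ltnW.
  have /andP[_ h] := interlaceP w n 1 n1; exact: (le_trans h b1).
- by rewrite !szf.
- rewrite szf => i i_n; rewrite !nthf !andbF.
  have /andP[h1 h2] := interlaceP w n i i_n.
  case: (asboolP (first_active N w n)) => [fn|nfn].
    have [b1 b2 b3] := move_top_bounds N w n N0 fn.
    rewrite asboolF/=; last exact: first_activeS.
    by case: i i_n h1 h2 => [|i]//= i_n h1 h2; [rewrite b1|rewrite h1 h2].
  case: (asboolP (first_active N w n.+1)) => [fn|_]/=; last by rewrite h1.
  have [b1 b2 b3] := move_top_bounds N w n.+1 N0 fn.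
  by case: i i_n h1 h2 => [|i]//= i_n h1 h2; rewrite h1.
Qed.

Section Flip.
Variables (N : nat) (N0 : (0 < N)%N).

Lemma vert_flip w n : vert (flip N w) n = flip_raw N w n.
Proof. by rewrite /flip; case: pselect => // /(_ (flip_raw_ipath N w N0)). Qed.

Lemma vert_flipN w n : ~ first_active N w n -> vert (flip N w) n = vert w n.
Proof. by move=> h; rewrite vert_flip /flip_raw asboolF. Qed.

Lemma vert_flipF w n : first_active N w n ->
  vert (flip N w) n = (top w n + move_top w n) :: behead (vert w n).
Proof. by move=> h; rewrite vert_flip /flip_raw asboolT. Qed.

Lemma flip_id w : (forall n, ~ first_active N w n) -> flip N w = w.
Proof. by move=> h; apply: vert_inj => n; exact: vert_flipN. Qed.

Lemma off_flipN w n m : first_active N w n -> (N < m)%N -> odd (m - N) -> m != n ->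
  off (flip N w) m = off w m /\ active (flip N w) m = active w m.
Proof.
move=> fn Nm om mn; have [Nn on _ _] := fn.
have h k : k != n -> vert (flip N w) k = vert w k.
  by move=> kn; apply: vert_flipN => /(first_active_uniq _ _ _ _ fn) e; rewrite e eqxx in kn.
have h1 : vert (flip N w) m.-1 = vert w m.-1 by apply: h; apply/eqP; lia.
have h2 : vert (flip N w) m.+1 = vert w m.+1 by apply: h; apply/eqP; lia.
by rewrite /active /off /second /top h1 h2 h.
Qed.

Lemma off_flipF w n : first_active N w n ->
  [/\ off (flip N w) n = off w n + move_top w n, active (flip N w) n &
      odd (absz (off (flip N w) n)) = ~~ odd (absz (off w n))].
Proof.
move=> fn; have [Nn on an _] := fn.
have h k : k != n -> vert (flip N w) k = vert w k.
  by move=> kn; apply: vert_flipN => /(first_active_uniq _ _ _ _ fn) e; rewrite e eqxx in kn.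
have h1 : vert (flip N w) n.-1 = vert w n.-1 by apply: h; apply/eqP; lia.
have h2 : vert (flip N w) n.+1 = vert w n.+1 by apply: h; apply/eqP; lia.
have eo : off (flip N w) n = off w n + move_top w n.
  by rewrite /off /second /top h1 h2 vert_flipF//= -!/(top _ _); lia.
have n1 : (1 < n)%N by exact: leq_ltn_trans N0 Nn.
have o0 := off_ge0 w n n1.
have eodd : odd (absz (off (flip N w) n)) = ~~ odd (absz (off w n)).
  rewrite eo /move_top; case: ifP => od; first by have := odd_absz _ o0 od; lia.
  by lia.
(* After a move up the offset is odd, hence active. After a move down it is even, and the former
   value of the entry shows that there is room above. *)
split=> //; rewrite /active eodd; case od : (odd _) => //=.
have /andP[_ h3] := interlaceP w n 0 (ltnW n1).
rewrite {2}/top h2 -/(top w n.+1) {1}/top vert_flipF//= /move_top od.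
by rewrite (lt_le_trans _ h3)// -/(top w n); lia.
Qed.

Lemma first_active_flip w n : first_active N w n -> first_active N (flip N w) n.
Proof.
move=> fn; have [Nn on an h] := fn; have [_ a _] := off_flipF w n fn.
split=> // m /andP[Nm mn] om.
have [_ ->] := off_flipN w n m fn Nm om (negbT (ltn_eqF mn)).
by apply: h => //; rewrite Nm.
Qed.

(** The moved path has the same first active level, and the parity of its offset is reversed, so the
    second move undoes the first. *)
Lemma flipK : involutive (flip N).
Proof.
move=> w; have [[n fn]|/forallNP h] := pselect (exists n, first_active N w n); last first.
  by rewrite !flip_id.
have fn' := first_active_flip w n fn; have [_ _ eo] := off_flipF w n fn.
apply: vert_inj => k; have [->|kn] := eqVneq k n.
  rewrite vert_flipF// /top vert_flipF//= -/(top w n).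
  have -> : move_top (flip N w) n = - move_top w n.
    by rewrite /move_top eo; case: odd => //=; rewrite opprK.
  rewrite addrK /top; have := size_vert w n; case: (vert w n) => //= n0.
  by case: fn => Nn; rewrite -n0 in Nn.
have h v : first_active N v n -> vert (flip N v) k = vert v k.
  by move=> fv; apply: vert_flipN => /(first_active_uniq _ _ _ _ fv) e; rewrite e eqxx in kn.
by rewrite !h.
Qed.

Lemma trunc_flip w : trunc (flip N w) N = trunc w N.
Proof.
apply/trunc_eqP => i iN; apply: vert_flipN => -[Ni _ _ _].
by rewrite ltnNge iN in Ni.
Qed.

Lemma flip_tail w n : first_active N w n -> tail_eq n.+1 w (flip N w).
Proof.
move=> fn k nk; rewrite vert_flipN// => /(first_active_uniq _ _ _ _ fn) e.
by rewrite e ltnn in nk.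
Qed.

Lemma cocycle_flip w n : first_active N w n -> cocycle w (flip N w) = move_top w n.
Proof.
move=> fn; rewrite (cocycleE _ _ _ (flip_tail w n fn)) /height !big_ord_recr/=.
rewrite (eq_bigr (fun i : 'I_n => sumi (vert w i))); last first.
  move=> i _; rewrite vert_flipN// => /(first_active_uniq _ _ _ _ fn) e.
  by have := ltn_ord i; rewrite -e ltnn.
have sE : sumi (vert w n) = top w n + sumi (behead (vert w n)).
  rewrite /top /sumi; case: (vert w n) (size_vert w n) => /= [n0|x s _].
    by case: fn => Nn; rewrite -n0 in Nn.
  by rewrite big_cons.
by rewrite vert_flipF// sE /sumi big_cons; ring.
Qed.

Lemma local_first w w' n : trunc w n.+1 = trunc w' n.+1 -> first_active N w n ->
  first_active N w' n.
Proof.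
move=> /trunc_eqP e [Nn on an h].
have ea m : (m <= n)%N -> active w' m = active w m.
  move=> mn; have e0 : vert w m = vert w' m by apply: e; exact: leqW.
  have e1 : vert w m.-1 = vert w' m.-1 by apply: e; rewrite (leq_trans (leq_pred _))// leqW.
  have e2 : vert w m.+1 = vert w' m.+1 by exact: e.
  by rewrite /active /off /second /top e0 e1 e2.
split=> //; first by rewrite ea.
by move=> m /[dup] /andP[_ mn] Nmn om; rewrite ea ?(ltnW mn)//; exact: h.
Qed.

Lemma measurable_flip : measurable_fun setT (flip N : OmegaM -> OmegaM).
Proof.
(* One extra row is required because activity at level [M] refers to row [M + 1]. *)
apply: measurable_local => M; exists M.+1 => w w' e.
have ew := proj1 (trunc_eqP _ _ _) e.
apply/trunc_eqP => i iM; rewrite !vert_flip /flip_raw.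
have ei v v' : trunc v M.+1 = trunc v' M.+1 -> trunc v i.+1 = trunc v' i.+1.
  move=> /trunc_eqP h; apply/trunc_eqP => j ji; apply: h; exact: (leq_trans ji).
have -> : `[< first_active N w i >] = `[< first_active N w' i >].
  by apply/asboolP/asboolP; apply: local_first; apply: ei.
have e0 : vert w i = vert w' i by apply: ew; exact: leqW.
case: asboolP => [[Ni _ _ _]|//].
have e1 : vert w i.-1 = vert w' i.-1 by apply: ew; rewrite (leq_trans (leq_pred _))// leqW.
have e2 : vert w i.+1 = vert w' i.+1 by exact: ew.
by rewrite /move_top /off /second /top e0 e1 e2.
Qed.

Lemma full_group_flip : full_group (flip N).
Proof.
apply/full_groupP; split; first exact: measurable_flip.
  by exists (flip N); split; [exact: measurable_flip|exact: flipK|exact: flipK].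
move=> w; have [[n fn]|/forallNP h] := pselect (exists n, first_active N w n).
  by exists n.+1; exact: flip_tail.
by exists 0%N; rewrite flip_id.
Qed.

Definition flippable : set OmegaM := [set w | exists n, first_active N w n].
Definition flip_up : set OmegaM :=
  [set w | exists2 n, first_active N w n & ~~ odd (absz (off w n))].

Lemma measurable_flippable : measurable flippable.
Proof.
rewrite (_ : flippable = \bigcup_n [set w | first_active N w n]).
  apply: bigcupT_measurable => n; apply: (measurable_saturated n.+1).
  by move=> w w' e; exact: local_first.
by apply/seteqP; split=> w [n]; [exists n|exists n].
Qed.

Lemma measurable_flip_up : measurable flip_up.
Proof.
rewrite (_ : flip_up = \bigcup_n [set w | first_active N w n /\ ~~ odd (absz (off w n))]).
  apply: bigcupT_measurable => n; apply: (measurable_saturated n.+1).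
  move=> w w' e [fn o]; split; first exact: local_first fn.
  have /trunc_eqP ew := e; rewrite /off /second /top -!ew//.
  by rewrite (leq_trans (leq_pred _)).
by apply/seteqP; split=> w; [move=> [n]; exists n|move=> [n _ []]; exists n].
Qed.

(** The involution reverses the parity of the offset, so it exchanges the paths moved up with those
    moved down; it respects [F] because the first [N] rows stay fixed. *)
Lemma flip_image_up (F : set OmegaM) : saturated N F ->
  flip N @` (F `&` flip_up) = (F `&` flippable) `\` flip_up.
Proof.
move=> sF; apply/seteqP; split=> w.
  move=> [v [Fv [n fn o]] <-]; split; first split.
  - by apply: sF Fv; rewrite trunc_flip.
  - by exists n; exact: first_active_flip.
  move=> [m fm]; have e := first_active_uniq _ _ _ _ fm (first_active_flip _ _ fn).
  by subst m; have [_ _ ->] := off_flipF v n fn; rewrite o.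
move=> [[Fw [n fn]] nu]; exists (flip N w); last exact: flipK.
split; first by apply: sF Fw; rewrite trunc_flip.
exists n; first exact: first_active_flip.
have [_ _ ->] := off_flipF w n fn; rewrite negbK; apply: contrapT => /negP o.
by apply: nu; exists n.
Qed.

Lemma cocycle_flip_up w : flip_up w -> cocycle w (flip N w) = 1.
Proof. by move=> [n fn o]; rewrite (cocycle_flip w n fn) /move_top (negbTE o). Qed.
End Flip.

(** The largest entry grows strictly at some level beyond [N + 1], and this level is at odd distance
    from [N] or from [N + 1]. *)
Lemma flippable_unbounded N w : (forall M : int, exists n, M < top w n) ->
  flippable N w \/ flippable N.+1 w.
Proof.
move=> h; have [n Nn tn] : exists2 n, (N.+1 < n)%N & top w n < top w n.+1.
  (* The maximum with 0 excludes row 0, which is empty and has 0 as its default largest entry. *)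
  apply: contrapT => /forall2NP hn; have [m] := h (Num.max (top w N.+2) 0).
  rewrite gt_max => /andP[hm m0].
  have top_le k : top w k.+1 <= top w k.+2 by have /andP[] := interlaceP w k.+1 0 isT.
  have e k : top w (N.+2 + k) = top w N.+2.
    elim: k => [|k IH]; first by rewrite addn0.
    have [/negP|/negP] := hn (N.+2 + k)%N; first by rewrite -leqNgt => ?; exfalso; lia.
    by rewrite -leNgt addnS -IH => le1; apply/eqP; rewrite eq_le le1 addSn top_le.
  case: (leqP m N.+2) => mN.
    have {}e k : (0 < k)%N -> (k <= N.+2)%N -> top w k <= top w N.+2.
      move=> k0 /subnK <-; elim: (N.+2 - k)%N => [//|d IH].
      by rewrite (le_trans IH)// addSn -(prednK k0) addnS top_le.
    case: m hm m0 mN => [|m] hm m0 mN; first by rewrite /top vert0 ltxx in m0.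
    by have := e m.+1 isT mN; rewrite leNgt hm.
  by have := e (m - N.+2)%N; rewrite subnKC ?(ltnW mN)// => e'; rewrite e' ltxx in hm.
have an : active w n by rewrite /active tn orbT.
case on : (odd (n - N)).
  by left; apply: active_exists on an; lia.
by right; apply: active_exists an => //; lia.
Qed.

Lemma exact_ratio1 (R : realType) (q : R) (P : probability OmegaM R) :
  0 < q < 1 -> q_central q P ->
  {ae P, forall w, forall M : int, exists n, M < top w n} -> exact_ratio P 1.
Proof.
move=> q01 qc hU A mA PA.
have [q0 q1] := andP q01.
have mG N := measurable_flippable N; have mU N := measurable_flip_up N.
pose p := pr P A; have p0 : 0 < p by rewrite -pr_gt0.
pose Q := q ^+ 2; have Q0 : 0 < Q by rewrite exprn_gt0.
have Q1 : Q < 1 by rewrite exprn_ilt1// ltW.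
(* The factor [Q] makes up for the contraction by [g] of the paths moved up: an image of measure at
   most [eps] comes from a set of measure at most [p / 16]. *)
pose eps := p * Q / 16; have e0 : 0 < eps by rewrite divr_gt0// mulr_gt0.
have [_ /(_ _ e0)[N0 [F [sF AF FA]]]] := measurable_approximable P A mA.
(* Almost every path is flippable for one of two consecutive starting levels, so one of the two
   captures half of [A]. *)
have [N [N1 NN0 AG]] : exists N, [/\ (0 < N)%N, (N0 <= N)%N & p / 2 <= pr P (A `&` flippable N)].
  have : p <= pr P (A `&` flippable N0.+1) + pr P (A `&` flippable N0.+2).
    have m1 : measurable (A `&` flippable N0.+1) by exact: measurableI.
    have m2 : measurable (A `&` flippable N0.+2) by exact: measurableI.
    have mZ : measurable (~` (flippable N0.+1 `|` flippable N0.+2)).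
      by apply: measurableC; exact: measurableU.
    have Z0 : pr P (~` (flippable N0.+1 `|` flippable N0.+2)) = 0.
      rewrite /pr (_ : P _ = 0%E)//; apply/(negligibleP P mZ).
      apply: negligibleS hU => w nG; apply: contra_not nG; exact: flippable_unbounded.
    rewrite -(addr0 (pr P (A `&` flippable N0.+1))) -Z0 -addrA [X in _ + X]addrC addrA.
    rewrite (@le_trans _ _ (pr P (A `&` flippable N0.+1 `|` A `&` flippable N0.+2) +
       pr P (~` (flippable N0.+1 `|` flippable N0.+2))))//.
      apply: prUD => //; first exact: measurableU.
      move=> w Aw; have [[?|?]|?] := pselect ((flippable N0.+1 `|` flippable N0.+2) w).
      - by left; left.
      - by left; right.
      - by right.
    by rewrite lerD2r prU.
  case: (lerP (p / 2) (pr P (A `&` flippable N0.+1))) => [h _|h h'].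
    by exists N0.+1; split=> //; exact: leqW.
  by exists N0.+2; split=> //; [do 2 apply: leqW|lra].
have {}sF : saturated N F := saturated_le _ _ _ NN0 sF.
have mF := measurable_saturated _ _ sF.
pose g : OmegaM -> OmegaM := flip N; have fg : full_group g := full_group_flip N N1.
have mgA : measurable (g @^-1` A).
  by rewrite -[X in measurable X]setTI; have [mg _] := fg; exact: mg.
have img (E : set OmegaM) : measurable E -> E `<=` flip_up N -> pr P (g @` E) = Q * pr P E.
  move=> mE EU; rewrite /pr (full_group_image q P q01 qc g E 1)//; last first.
    by move=> w /EU; exact: cocycle_flip_up.
  by rewrite mulr1 -exprnP fineM// fin_numP.
(* [X] is the part of [B] sent outside [A], and [C] the part that starts and ends in [A]. The paths
   moved up have at least half the measure of the flippable part of [F], so [B] has measure at least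
   [7 * p / 32], of which at most [p / 8] is lost in passing to [C]. *)
pose B := F `&` flip_up N; have mB : measurable B by exact: measurableI.
pose X := B `\` g @^-1` A; have mX : measurable X by exact: measurableD.
pose C := (A `&` B) `&` g @^-1` A.
have mC : measurable C by apply: measurableI => //; exact: measurableI.
have mAF : measurable (A `\` F) by exact: measurableD.
have mFA : measurable (F `\` A) by exact: measurableD.
have gX : Q * pr P X <= eps.
  rewrite -img//; last by move=> w [[]].
  apply: (le_trans _ (ltW FA)); apply: pr_le => //; first exact: measurable_image.
  move=> _ [w [[Fw _] nA] <-]; split=> //; apply: sF Fw; by rewrite trunc_flip.
have gB : pr P (F `&` flippable N) <= pr P B + Q * pr P B.
  rewrite -img//; last by move=> w [].
  have mFG : measurable (F `&` flippable N) by exact: measurableI.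
  apply: prUD => //; first exact: measurable_image.
  move=> w [Fw Gw]; have [Uw|nU] := pselect (flip_up N w); first by left.
  by right; rewrite /g flip_image_up.
have hAG : pr P (A `&` flippable N) <= pr P (F `&` flippable N) + pr P (A `\` F).
  apply: prUD => //; try exact: measurableI.
  by move=> w [Aw Gw]; have [Fw|nF] := pselect (F w); [left|right].
have hB : pr P B <= pr P C + pr P (F `\` A) + pr P X.
  rewrite (@le_trans _ _ (pr P (C `|` (F `\` A)) + pr P X))// ?lerD2r ?prU//.
  apply: prUD => //; first exact: measurableU.
  move=> w Bw; have [gA|ngA] := pselect (A (g w)); last by right.
  by left; have [Aw|nA] := pselect (A w); [left|right; split=> //; case: Bw].
have xe : pr P X <= p / 16.
  have eE : Q * (p / 16) = eps by rewrite /eps; ring.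
  by rewrite -(ler_pM2l Q0) eE.
have ee : eps <= p / 16 by rewrite /eps ler_pM2r// ger_pMr// ltW.
have QB : Q * pr P B <= pr P B by rewrite ler_piMl ?pr_ge0 ?ltW.
exists C, g; split; last by move=> w [[_ [_ Uw]] _]; exact: cocycle_flip_up.
split=> //; last 2 first.
- by move=> w [[]].
- by move=> _ [w [_ Aw] <-].
- by rewrite pr_gt0//; lra.
Qed.

(** * The support of the measure *)

(* Rows are non-increasing lists, so [bt v i] is their [i]-th smallest entry,
   counted from 0. *)
Definition bt (v : seq int) (i : nat) : int := nth 0 (rev v) i.

Lemma btE v i : (i < size v)%N -> bt v i = nth 0 v (size v - i.+1).
Proof. by move=> iv; rewrite /bt nth_rev. Qed.

Lemma interlace_bt mu la i : interlace mu la -> (i < size mu)%N ->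
  bt la i <= bt mu i <= bt la i.+1.
Proof.
move=> [sl h] im; have := h (size mu - i.+1)%N.
rewrite !btE ?sl//; last by rewrite ltnW.
by rewrite subSS -subSn// subSS; apply; lia.
Qed.

Lemma fpath_bt s j k i : Defs.fpath s -> (j + k < size s)%N -> (i < size (nth [::] s j))%N ->
  bt (nth [::] s (j + k)) i <= bt (nth [::] s j) i <= bt (nth [::] s (j + k)) (i + k).
Proof.
move=> [s0 [h1 h2]]; elim: k => [|k IH]; first by rewrite !addn0 lexx.
rewrite !addnS => jk ij; have /andP[l1 l2] := IH (ltnW jk) ij.
have sz l : (l < size s)%N -> size (nth [::] s l) = (size (nth [::] s 0) + l)%N.
  by move=> /h1[].
have sj : size (nth [::] s (j + k)) = (size (nth [::] s j) + k)%N.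
  by rewrite (sz (j + k)%N (ltnW jk)) (sz j (leq_ltn_trans (leq_addr k.+1 j) _)) ?addnS// addnA.
have hi := h2 (j + k)%N jk.
have /andP[m1 _] := interlace_bt _ _ i hi (leq_trans ij (leq_trans (leq_addr _ _) (eq_leq (esym sj)))).
have ik : (i + k < size (nth [::] s (j + k)))%N by rewrite sj ltn_add2r.
have /andP[_ m2] := interlace_bt _ _ (i + k) hi ik.
by rewrite (le_trans m1 l1) (le_trans l2 m2).
Qed.

Lemma paths_between_bt mu la s i : paths_between mu la s -> (i < size mu)%N ->
  [/\ (size mu <= size la)%N, bt la i <= bt mu i & bt mu i <= bt la (i + (size la - size mu))].
Proof.
move=> [fs [<- <-]]; rewrite -nth0 => imu.
have [s0 [h1 _]] := fs; have ss : (0 < size s)%N by case: s s0 {fs h1 imu}.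
have sl : size (last [::] s) = (size (nth [::] s 0) + (size s).-1)%N.
  by rewrite -nth_last; have [] := h1 (size s).-1 (eq_leq (prednK ss)).
have := fpath_bt s 0 (size s).-1 i fs; rewrite add0n nth_last.
rewrite (eq_leq (prednK ss)) => /(_ isT imu) /andP[b1 b2].
by rewrite sl leq_addr addKn.
Qed.

Lemma size_lam_theta theta m : size (lam_theta theta m) = m.
Proof. by rewrite size_rev size_mkseq. Qed.

Lemma bt_lam_theta theta m i : (i < m)%N -> bt (lam_theta theta m) i = theta i.
Proof. by move=> im; rewrite /bt /lam_theta revK nth_mkseq. Qed.

Lemma eq_from_bt u v : size u = size v ->
  (forall i, (i < size u)%N -> bt u i = bt v i) -> u = v.
Proof.
move=> suv h; rewrite -(revK u) -(revK v); congr rev.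
apply: (@eq_from_nth _ 0); first by rewrite !size_rev.
by move=> i; rewrite size_rev; exact: h.
Qed.

Lemma bt_nseq n (c : int) i : (i < n)%N -> bt (nseq n c) i = c.
Proof. by move=> i_n; rewrite btE size_nseq// nth_nseq ifT//; lia. Qed.

Lemma topE w n : top w n.+1 = bt (vert w n.+1) n.
Proof. by rewrite btE ?size_vert// subnn. Qed.

Lemma measurable_set1_Omega (w : OmegaM) : measurable [set w].
Proof.
rewrite (_ : [set w] = \bigcap_n cyl (trunc w n)).
  by apply: bigcapT_measurable => n; exact: (measurable_cyl _ (trunc_from_star w n)).
apply/seteqP; split=> v; first by move=> -> n _; exact/cyl_trunc.
move=> h; apply: vert_inj => n.
by have /cyl_trunc/trunc_eqP := h n I; apply.
Qed.

Section Support.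
Context {R : realType} (q : R) (theta : nat -> int) (P : probability OmegaM R).
Hypotheses (q01 : 0 < q < 1) (theta_le : forall i, theta i <= theta i.+1).
Hypotheses (qc : q_central q P) (Pt : is_P_theta q theta P).

Definition in_support (w : OmegaM) := forall N, P (cyl (trunc w N)) <> 0%E.

(** There are countably many cylinders, so the union of the null ones is null. *)
Lemma ae_support : {ae P, forall w, in_support w}.
Proof.
pose F (o : option (seq (seq int))) : set OmegaM := if o is Some a then
  if `[< from_star a /\ P (cyl a) = 0%E >] then cyl a else set0 else set0.
apply: (@negligibleS _ _ _ P (\bigcup_n F (unpickle n))).
  move=> w /existsNP[N /contrapT h]; exists (pickle (trunc w N)) => //.
  rewrite pickleK /F asboolT; first by apply/cyl_trunc.
  by split=> //; exact: trunc_from_star.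
apply: negligible_bigcup => n; case: (unpickle n) => [a|]; last exact: negligible_set0.
rewrite /F; case: asboolP => [[fa a0]|_]; last exact: negligible_set0.
by apply/negligibleP => //; exact: measurable_cyl.
Qed.

(** If no path joined row [N] to any [lambda(m; theta)], all quotients of dimensions would be 0, and
    so would their limit, contradicting that the cylinder is charged. Interlacing along a joining
    path gives both bounds. *)
Lemma support_bt w N : in_support w -> exists2 m, (N <= m)%N &
  forall i, (i < N)%N -> theta i <= bt (vert w N) i <= theta (i + (m - N)).
Proof.
move=> /(_ N) PN; have [q0 _] := andP q01.
have [m [s ps]] : exists m, exists s, paths_between (vert w N) (lam_theta theta m) s.
  apply: contrapT => /forallNP h; apply: PN.
  have := Pt _ _ _ (vert_sign w N) (trunc_path w N).
  rewrite (_ : (fun n => _) = cst 0); last first.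
    apply/funext => m; rewrite /dimq (_ : paths_between _ _ = set0) ?fsbig_set0 ?mul0r//.
    by rewrite -subset0 => s ps; apply: (h m); exists s.
  move=> /(cvg_lim (@Rhausdorff R)).
  rewrite (cvg_lim (@Rhausdorff R) (cvg_cst (0 : R))) => /esym/eqP.
  have pn : pw q (trunc w N) != 0.
    have qn := lt0r_neq0 q0; by rewrite pw_truncE// expfz_neq0.
  rewrite mulf_eq0 invr_eq0 (negbTE pn) orbF.
  move=> /eqP e; rewrite -[LHS]fineK ?e//.
  by rewrite fin_numP//; exact: (measurable_cyl _ (trunc_from_star w N)).
have [Nm|mN] := leqP N m; last first.
  have [N0|N0] := posnP N; first by rewrite N0 in mN.
  have := paths_between_bt _ _ _ 0 ps; rewrite size_vert size_lam_theta => /(_ N0)[].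
  by rewrite leqNgt mN.
exists m => // i iN; have := paths_between_bt _ _ _ i ps.
rewrite size_vert size_lam_theta => /(_ iN)[_].
by rewrite !bt_lam_theta; [move=> -> ->|lia|lia].
Qed.

Lemma support_top w n : in_support w -> theta n <= top w n.+1.
Proof.
move=> sw; rewrite topE; have [m _ /(_ n (leqnn _))/andP[]//] := support_bt w n.+1 sw.
Qed.

Lemma theta_mono i j : (i <= j)%N -> theta i <= theta j.
Proof. by move=> /subnK <-; elim: (j - i)%N => [//|d IH]; rewrite (le_trans IH)// addSn. Qed.

Lemma unbounded_top : ~ (exists M : int, forall i, `|theta i| <= M) ->
  {ae P, forall w, forall M : int, exists n, M < top w n}.
Proof.
move=> hn; apply: filterS ae_support => w sw M.
(* A bound on the largest entries bounds [theta] from above, and monotonicity bounds it from below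
   by its first term. *)
apply: contrapT => /forallNP h; apply: hn; exists (Num.max `|theta 0%N| `|M|) => i.
have h1 := support_top w i sw; have h2 := h i.+1.
have h3 := theta_mono 0 i (leq0n i).
rewrite le_max; have [t0|t0] := lerP 0 (theta i).
  by apply/orP; right; lia.
by apply/orP; left; lia.
Qed.

(** * Atoms, and the case of a constant sequence *)

Lemma atom_set1 (w : OmegaM) : (0 < P [set w])%E -> atom P [set w].
Proof.
move=> Pw; split=> //; first exact: measurable_set1_Omega.
move=> B _ /subset_set1[->|->]; [left; exact: measure0|by right].
Qed.

Lemma ae_measure0 (Q : OmegaM -> Prop) (A : set OmegaM) : measurable A ->
  {ae P, forall w, Q w} -> (forall w, Q w -> ~ A w) -> P A = 0%E.
Proof.
move=> mA hQ QA; apply/(negligibleP P mA); apply: negligibleS hQ => w Aw /QA; exact.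
Qed.

Lemma atomic_single_of w0 : {ae P, forall w, w = w0} -> atomic_single P.
Proof.
move=> h; have P0 A : measurable A -> ~ A w0 -> P A = 0%E.
  by move=> mA nA; apply: (ae_measure0 _ _ mA h) => w ->.
have m0 := measurable_set1_Omega w0.
have Pw0 : (0 < P [set w0])%E.
  rewrite lt0e measure_ge0 andbT; apply/eqP => e.
  have : P (~` [set w0]) = 0%E by apply: P0; [exact: measurableC|apply].
  by rewrite probability_setC// e sube0 => /eqP; rewrite onee_eq0.
have mem A : measurable A -> (0 < P A)%E -> A w0.
  by move=> mA PA; apply: contrapT => nA; rewrite P0// ltxx in PA.
split.
  move=> A mA PA; exists [set w0]; split; last exact: atom_set1.
  by move=> _ ->; exact: mem.
exists [set w0]; split; first exact: atom_set1.
move=> B [mB PB _]; have Bw0 := mem B mB PB.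
apply: P0; first by apply: measurableU; exact: measurableD.
by move=> [[_ /(_ Bw0)]|[_ /(_ erefl)]].
Qed.

(** Both bounds of [support_bt] equal the constant, which leaves a single path in the support. *)
Lemma constant_atomic : (forall i, theta i = theta 0%N) -> atomic_single P.
Proof.
move=> tc; pose c := theta 0%N.
have sc w : in_support w -> forall n, vert w n = nseq n c.
  move=> sw n; apply: eq_from_bt; first by rewrite size_vert size_nseq.
  move=> i; rewrite size_vert => i_n; rewrite bt_nseq//.
  have [m _ /(_ i i_n)] := support_bt w n sw.
  by rewrite tc [theta (i + _)]tc -/c -eq_le => /eqP.
have [w0 sw0] : exists w, in_support w.
  apply: contrapT => /forallNP h.
  have := ae_measure0 _ _ (@measurableT _ OmegaM) ae_support.
  by rewrite probability_setT => /(_ (fun w sw => False_ind _ (h w sw)))/eqP; rewrite onee_eq0.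
apply: (atomic_single_of w0); apply: filterS ae_support => w sw.
by apply: vert_inj => n; rewrite !sc.
Qed.

(** Exchanging the two initial segments is an element of the full group that sends one point to the
    other, and it multiplies the mass by a positive power of [q]. *)
Lemma point_mass (w w' : OmegaM) N : tail_eq N w w' ->
  (0 < P [set w])%E -> (0 < P [set w'])%E.
Proof.
move=> ww' Pw; have wN := ww' N (leqnn N).
have := swap_act_trunc _ _ _ ww'; set g := swap_act _ _ _ _ => gw.
have sla := vert_sign w N; have pa := trunc_path w N.
have pb : paths_to (vert w N) (trunc w' N) by rewrite wN; exact: trunc_path.
have fg : full_group (g : OmegaM -> OmegaM).
  have mg : measurable_fun setT (g : OmegaM -> OmegaM) by exact: measurable_swap_act.
  apply/full_groupP; split=> //; first by exists g; split=> //; exact: swap_actK.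
  by move=> v; exists N; exact: swap_act_tail.
have := image_pos q P q01 qc g [set w] (cocycle w w') fg (measurable_set1_Omega w).
by rewrite image_set1 gw; apply=> // _ ->; rewrite gw.
Qed.

(** Countably many sets with at most one point each carry the measure, so one of them meets [A] in a
    charged point. *)
Lemma atoms_of_countable (I : countType) (F : I -> set OmegaM) :
  (forall i w w', F i w -> F i w' -> w = w') ->
  {ae P, forall w, exists i, F i w} ->
  forall A : set OmegaM, measurable A -> (0 < P A)%E ->
  exists2 w, A w & (0 < P [set w])%E.
Proof.
move=> F1 hF A mA PA.
have mF i : measurable (F i).
  have [->|/set0P[w Fw]] := eqVneq (F i) set0; first exact: measurable0.
  rewrite (_ : F i = [set w]); first exact: measurable_set1_Omega.
  by apply/seteqP; split=> [v Fv|_ ->//]; exact: F1 Fw.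
have mU : measurable (\bigcup_i F i).
  by apply: countable_bigcupT_measurable => //; exact: countableP.
have PB : (0 < P (A `&` \bigcup_i F i))%E.
  suff : P A = P (A `&` \bigcup_i F i) by move=> <-.
  have A0 : P (A `\` \bigcup_i F i) = 0%E.
    apply: (ae_measure0 _ _ _ hF); first exact: measurableD.
    by move=> w [i Fi] [_]; apply; exists i.
  apply: (etrans (measureDI P mA mU)).
  exact: etrans (congr1 (fun x => (x + _)%E) A0) (add0e _).
have [i Pi] := countable_cover_pos R P I F _ mF (measurableI _ _ mA mU) (@subIsetr _ _ _) PB.
set B := A `&` _ `&` F i in Pi.
have [e|/set0P[w [[Aw _] Fw]]] := eqVneq B set0; first by rewrite e measure0 ltxx in Pi.
exists w => //; rewrite (lt_le_trans Pi)// le_measure ?inE//.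
- by apply: measurableI => //; exact: measurableI.
- exact: measurable_set1_Omega.
- by move=> v [_ Fv]; exact: F1 Fw.
Qed.
End Support.

(** * Comparison of dimensions *)

Lemma sumi_le (c : int) (v : seq int) : (forall x, x \in v -> x <= c) -> sumi v <= c * (size v)%:Z.
Proof.
rewrite /sumi; elim: v => [|x v IH] h; first by rewrite big_nil mulr0.
rewrite big_cons /= intS mulrDr mulr1 lerD ?h ?mem_head// IH// => y yv.
by rewrite h// inE yv orbT.
Qed.

Lemma sumi_lt (c : int) (v : seq int) : (forall x, x \in v -> x <= c) ->
  v != nseq (size v) c -> sumi v <= c * (size v)%:Z - 1.
Proof.
rewrite /sumi; elim: v => [//|x v IH] h.
have hv y : y \in v -> y <= c by move=> yv; rewrite h// inE yv orbT.
rewrite big_cons /= intS mulrDr mulr1 eqseq_cons negb_and.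
have xc : x <= c by rewrite h// mem_head.
have := sumi_le c v hv; rewrite /sumi => h1.
have [-> /= /(IH hv)|xc' _] := eqVneq x c; first by lra.
have lt_xc : x < c by rewrite lt_neqAle xc'.
have : x <= c - 1 by lia.
by lra.
Qed.

Lemma find_eq (T : Type) (x0 : T) (p : pred T) s j : (j < size s)%N ->
  p (nth x0 s j) -> (forall i, (i < j)%N -> ~~ p (nth x0 s i)) -> find p s = j.
Proof.
move=> js pj h; have hp : has p s by apply/(has_nthP x0); exists j.
case: (ltngtP (find p s) j) => // lt.
  by have := h _ lt; rewrite nth_find.
by have := before_find x0 lt; rewrite pj.
Qed.

Section Dimension.
Context {R : realType} (q : R).
Hypothesis q01 : 0 < q < 1.
Variables (c : int) (la : seq int).
Hypotheses (la_le : forall i, (i < size la)%N -> bt la i <= c).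
Hypothesis la_neq : la != nseq (size la) c.

Let q0 : 0 < q. Proof. by case/andP: q01. Qed.

Let nonconst (v : seq int) : bool := v != nseq (size v) c.
Let firstnc s := find nonconst s.

(* A path starting with a constant row [c] first leaves the constant rows at
   some level [T]; deleting the largest entry of row [T] gives an admissible
   row [T - 1], of smaller sum than the constant row that it replaces. *)
Let early (s : seq (seq int)) : seq (seq int) :=
  let s' := [::] :: s in set_nth [::] s' (firstnc s').-1 (behead (nth [::] s' (firstnc s'))).

(** Left inverse of [early] on paths from [[:: c]] to [la]: the shortened row is the first
    nonconstant one of the new path, so it can be located and made constant again. *)
Let late (y : seq (seq int)) : seq (seq int) :=
  behead (set_nth [::] y (firstnc y) (nseq (firstnc y) c)).

Section OnePath.
Variable s : seq (seq int).
Hypothesis ps : paths_between [:: c] la s.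

(** With the root prepended, the position of a row in the list is its level. *)
Let s' := [::] :: s.
Let T := firstnc s'.

Let ps' : paths_to la s'.
Proof.
have [[s0 [h1 h2]] [hd ls]] := ps.
split; [split=> //; split|split=> //].
- move=> [|i] /=; first by split.
  by rewrite ltnS => /h1; rewrite nth0 hd.
- move=> [|i] /=; last by rewrite ltnS; exact: h2.
  by move=> _; rewrite nth0 hd; split.
Qed.

Let size_row i : (i < size s')%N -> size (nth [::] s' i) = i.
Proof. by move=> is'; apply: from_star_size_nth => //; case: ps' => ? []. Qed.

Let last_row : nth [::] s' (size s').-1 = la.
Proof. by rewrite nth_last; case: ps' => _ []. Qed.

Let row_le i x : (i < size s')%N -> x \in nth [::] s' i -> x <= c.
Proof.
move=> is' /(nthP 0)[j]; rewrite size_row// => ji <-.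
have fs : Defs.fpath s' by case: ps'.
have := fpath_bt s' i ((size s').-1 - i) (i - j.+1) fs.
rewrite subnKC; last by rewrite -ltnS prednK.
rewrite prednK// leqnn size_row// => /(_ isT) h.
have /andP[_] : _ := h ltac:(lia).
rewrite (btE (nth [::] s' i)) ?size_row//; last by lia.
have -> : (i - (i - j.+1).+1 = j)%N by lia.
move=> /le_trans; apply; rewrite last_row; apply: la_le.
have -> : size la = (size s').-1 by rewrite -last_row size_row// prednK.
by have : (i < (size s').-1.+1)%N by []; move=> /= ?; lia.
Qed.

Let hasnc : has nonconst s'.
Proof.
apply/(has_nthP [::]); exists (size s').-1; first by rewrite prednK.
by rewrite last_row.
Qed.

Let T_lt : (T < size s')%N. Proof. by rewrite /T /firstnc -has_find. Qed.

Let T_gt1 : (1 < T)%N.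
Proof.
rewrite /T /firstnc ltnNge; apply/negP => h.
have := nth_find [::] hasnc; case: (find _ _) h => [|[|]]//= _.
by have [_ [hd _]] := ps; rewrite nth0 hd /nonconst eqxx.
Qed.

Let T_predK : T.-1.+1 = T.
Proof. by rewrite prednK// (ltn_trans _ T_gt1). Qed.

Let T_pred : (T.-1 < T)%N. Proof. by rewrite T_predK. Qed.

Let s'_pos : (T.-1 < size s')%N. Proof. exact: leq_ltn_trans (leq_pred _) T_lt. Qed.

Let const_row i : (i < T)%N -> nth [::] s' i = nseq i c.
Proof.
move=> iT; have := before_find [::] iT; rewrite /nonconst => /negbFE/eqP e.
by rewrite e size_row// (ltn_trans iT).
Qed.

Let xT := nth [::] s' T.
Let size_xT : size xT = T. Proof. exact: size_row. Qed.
Let size_bxT : size (behead xT) = T.-1. Proof. by rewrite size_behead size_xT. Qed.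

Let xT_c i : (i < T.-1)%N -> nth 0 xT i.+1 <= c <= nth 0 xT i.
Proof.
move=> iT; have [[_ [_ h]] _] := ps'.
have := h T.-1; rewrite T_predK => /(_ T_lt)[_ /(_ i)].
by rewrite (const_row _ T_pred) size_nseq nth_nseq iT; apply.
Qed.

(** The largest entry of row [T] is squeezed between [c] from row [T - 1] and the bound [c]. Were
    the remaining entries all [c], row [T] would be constant. *)
Let bxT_nonconst : nonconst (behead xT).
Proof.
rewrite /nonconst; apply/negP => /eqP e.
have T1 : (0 < T.-1)%N by move: T_gt1; lia.
have /andP[_ c0] := xT_c 0 T1.
have c1 : nth 0 xT 0 <= c.
  by apply: (row_le T _ T_lt); apply: mem_nth; rewrite size_xT (ltn_trans _ T_gt1).
have xE : xT = nth 0 xT 0 :: behead xT.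
  by case: xT size_xT => // T0; move: T_gt1; rewrite -T0.
have /negP := nth_find [::] hasnc; apply; change (xT == nseq (size xT) c).
rewrite size_xT xE e size_bxT; apply/eqP; rewrite -{2}T_predK /=; congr (_ :: _).
by apply/eqP; rewrite eq_le c1.
Qed.

Let earlyE : early s = set_nth [::] s' T.-1 (behead xT). Proof. by []. Qed.

Let size_early : size (early s) = size s'.
Proof. by rewrite earlyE size_set_nth; apply/maxn_idPr. Qed.

Let nth_early i : nth [::] (early s) i = if i == T.-1 then behead xT else nth [::] s' i.
Proof. by rewrite earlyE nth_set_nth. Qed.

(** Both new interlacing conditions follow from row [T] interlacing the constant row [T - 1], that
    is, from [xT_c]. *)
Let early_path : paths_to la (early s).
Proof.
have [[_ [h1 h2]] [hd ls]] := ps'.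
have T0 : (0 == T.-1)%N = false by apply/eqP; move: T_gt1; lia.
have e0 : nth [::] (early s) 0 = [::] by rewrite nth_early T0.
split; [split|split].
- by move=> /(congr1 size); rewrite size_early.
- split=> i; rewrite size_early => is'; rewrite ?e0 !nth_early.
    case: eqP => [->|_]; last exact: h1.
    split; first exact: size_bxT.
    rewrite -drop1; apply: drop_sorted.
    by have [] := h1 T T_lt.
  case: eqP => [e|ne].
    have -> : (i.+1 == T.-1) = false by apply/eqP; lia.
    have -> : i.+1 = T by rewrite e T_predK.
    split; first by rewrite size_bxT size_xT T_predK.
    move=> j; rewrite size_bxT nth_behead => jT.
    by have /andP[k1 k2] := xT_c j jT; rewrite lexx (le_trans k1 k2).
  case: eqP => [e|_]; last exact: h2.
  have iT : (i < T)%N by lia.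
  rewrite const_row//; split; first by rewrite size_nseq size_bxT e.
  move=> j; rewrite size_nseq => ji; rewrite nth_nseq ji !nth_behead.
  have /andP[_ ->] := xT_c j.+1 ltac:(lia).
  by have /andP[-> _] := xT_c j.+1 ltac:(lia).
- by rewrite -nth0.
- rewrite -nth_last size_early nth_early ifF; first by rewrite nth_last.
  by apply/eqP; move: T_lt T_gt1; lia.
Qed.

Let lateK : late (early s) = s.
Proof.
have -> : s = behead s' by [].
have fE : firstnc (early s) = T.-1.
  apply: (@find_eq _ [::]); first by rewrite size_early.
    by rewrite nth_early eqxx.
  move=> i iT; rewrite nth_early ltn_eqF// const_row; last by lia.
  by rewrite /nonconst size_nseq eqxx.
rewrite /late fE earlyE set_set_nth eqxx; congr behead.
apply: (@eq_from_nth _ [::]); first by rewrite size_set_nth; apply/maxn_idPr.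
move=> i _; rewrite nth_set_nth /=; case: eqP => [->|//].
by rewrite (const_row _ T_pred).
Qed.

Let pw_early : pw q s <= q ^+ 2 * pw q (early s).
Proof.
have s1 : (0 < size s)%N by have [[+ _] _] := ps; case: (s).
have es : pw q s = pw q s'.
  rewrite /pw /= -[in RHS](prednK s1) big_ord_recl /=.
  have [_ [hd _]] := ps; rewrite nth0 hd /ew /= /sumi big_nil.
  by rewrite mulr0 subrr mul0r subrr expr0z mul1r.
have fs' : from_star s' by case: ps' => ? [].
have fe : from_star (early s) by case: early_path => ? [].
have [_ [_ ls']] := ps'; have [_ [_ le']] := early_path.
rewrite es !pwE ?gt_eqF// ls' le' size_early exprnP -expfzDr ?gt_eqF//.
(* The replaced row lies strictly below the last one, so it counts in the height; its sum drops by
   at least 1, which is where the factor [q ^+ 2] comes from. *)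
have T1 : (T.-1 < (size s').-1)%N by rewrite T_predK; exact: T_lt.
have := sumi_lt c (behead xT) _ bxT_nonconst; rewrite size_bxT => sl.
have {}sl : sumi (behead xT) <= c * (T.-1)%:Z - 1.
  by apply: sl => x xb; apply: (row_le T x T_lt); exact: mem_behead.
have sc : sumi (nseq T.-1 c) = c * (T.-1)%:Z.
  by rewrite /sumi; elim: (T.-1) => [|k IH]; rewrite ?big_nil ?mulr0//= big_cons IH intS; ring.
have hd : height (nth [::] (early s)) (size s').-1 <= height (nth [::] s') (size s').-1 - 1.
  rewrite /height (bigD1 (Ordinal T1))//= [in leRHS](bigD1 (Ordinal T1))//=.
  rewrite [in leLHS](eq_bigr (fun i : 'I__ => sumi (nth [::] s' i))); last first.
    by move=> i iT; rewrite nth_early ifF//; exact: negbTE.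
  rewrite nth_early eqxx (const_row _ T_pred) sc.
  by move: sl; lia.
move: hd; move: (height (nth [::] (early s)) _) (height (nth [::] s') _) => h' h hd.
move: (_ * sumi la) => x.
have [n ->] : exists n : nat, 2 * h - x = (2 + (2 * h' - x)) + n%:Z.
  by case e : (2 * h - x - (2 + (2 * h' - x))) => [n|n]; [exists n|exfalso]; lia.
move: (2 + _) => a; rewrite expfzDr ?gt_eqF// ler_piMr//; first by rewrite exprz_ge0// ltW.
by rewrite -exprnP exprn_ile1 ?ltW//; case/andP: q01.
Qed.

Lemma early_spec : [/\ paths_to la (early s), late (early s) = s &
  pw q s <= q ^+ 2 * pw q (early s)].
Proof. by split; [exact: early_path|exact: lateK|exact: pw_early]. Qed.
End OnePath.

Lemma pw_gt0 s : 0 < pw q s.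
Proof. by rewrite /pw prodr_gt0// => i _; rewrite exprz_gt0. Qed.

Lemma dimq_ratio_le : dimq q [:: c] la / dimq1 q la <= q ^+ 2.
Proof.
(* Division by a zero dimension gives 0 by convention. *)
have [e|d0] := eqVneq (dimq1 q la) 0; first by rewrite e invr0 mulr0 exprn_ge0 ?ltW.
set A := paths_between [:: c] la; set B := paths_to la.
have fB : finite_set B.
  (* A sum over a set with infinitely many nonzero terms has the default value 0, so a nonzero
     dimension forces finitely many paths. *)
  apply: contrapT => iB; move/eqP: d0; apply; rewrite /dimq1 /dimq.
  apply: fsbig_dflt; rewrite (_ : _ `&` _ = B)//.
  by apply/seteqP; split=> [s []//|s Bs]; split=> //=; apply/eqP; rewrite gt_eqF// pw_gt0.
have fA : finite_set A.
  apply: (@sub_finite_set _ _ (late @` B)); last exact: finite_image.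
  by move=> s As; have [Be le_ _] := early_spec s As; exists (early s).
have le : (\sum_(s \in A) (pw q s)%:E <= \sum_(s \in B) (q ^+ 2 * pw q s)%:E)%E.
  apply: (@le_trans _ _ (\sum_(s \in A) (q ^+ 2 * pw q (early s))%:E)%E).
    by apply: lee_fsum => // s As; rewrite lee_fin; have [] := early_spec s As.
  rewrite -(fsbig_image A early (fun s => (q ^+ 2 * pw q s)%:E)).
    apply: lee_fsum_nneg_subset => //; first exact: finite_image.
      by move=> s; rewrite !inE => -[t At <-]; have [] := early_spec t At.
    by move=> s _; rewrite lee_fin mulr_ge0 ?exprn_ge0 ?ltW ?pw_gt0.
  move=> s t /set_mem As /set_mem At e.
  have [_ <- _] := early_spec s As; have [_ <- _] := early_spec t At.
  by rewrite e.
have dB : 0 < dimq1 q la.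
  rewrite lt_neqAle eq_sym d0 -lee_fin -(fsumEFin _ fB) fsume_ge0// => s _.
  by rewrite lee_fin ltW// pw_gt0.
rewrite ler_pdivrMr// -lee_fin EFinM -!(fsumEFin _ fA) -(fsumEFin _ fB).
rewrite ge0_mule_fsumr; last by move=> s; rewrite lee_fin ltW// pw_gt0.
by under [leRHS]eq_fsbigr do rewrite -EFinM.
Qed.
End Dimension.

(** * Eventually constant sequences *)

Lemma eventually_const (u : nat -> int) (M : int) :
  (forall i, u i <= u i.+1) -> (forall i, u i <= M) ->
  exists k, forall i, (k <= i)%N -> u i = u k.
Proof.
move=> hu hM.
(* Choose [k] where the distance to the bound [M] is least; afterwards the sequence can no longer
   increase. *)
have ex : exists d, `[< exists i, absz (M - u i) = d >].
  by exists (absz (M - u 0%N)); apply/asboolP; exists 0%N.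
case: (ex_minnP ex) => d /asboolP[k kd] hd; exists k => i ki.
have h1 : u k <= u i.
  by rewrite -(subnK ki); elim: (i - k)%N => [//|j IH]; rewrite (le_trans IH)// addSn.
have h2 : (d <= absz (M - u i))%N by apply: hd; apply/asboolP; exists i.
by have := hM i; have := hM k; lia.
Qed.

Section EventuallyConstant.
Context {R : realType} (q : R) (theta : nat -> int) (P : probability OmegaM R).
Hypotheses (q01 : 0 < q < 1) (theta_le : forall i, theta i <= theta i.+1).
Hypotheses (qc : q_central q P) (Pt : is_P_theta q theta P).
Variables (c : int) (k : nat).
Hypotheses (theta_k : forall i, (k <= i)%N -> theta i = c) (theta0 : theta 0%N < c).

Let theta_c i : theta i <= c.
Proof. by rewrite -(theta_k (maxn i k)) ?leq_maxr// theta_mono// leq_maxl. Qed.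

(** The measure is a limit of quotients of dimensions, each at most [q ^+ 2] by [dimq_ratio_le]: the
    row [lambda(m; theta)] is bounded by [c] and its least entry is less than [c]. *)
Lemma first_row_le : fine (P (cyl [:: [::]; [:: c]])) <= q ^+ 2.
Proof.
have s1 : is_sign 1 [:: c] by split.
have pa : paths_to [:: c] [:: [::]; [:: c]].
  split; [split=> //; split|by []].
    by move=> [|[|]]//= _; split.
  by move=> [|[|]]//= _; split.
have pw1 : pw q [:: [::]; [:: c]] = 1.
  by rewrite /pw /= big_ord_recl big_ord0 mulr1 /ew /= /sumi big_nil mulr0 subrr mul0r subrr expr0z.
have := Pt 1%N _ _ s1 pa; rewrite pw1 divr1.
apply: (closed_cvg (fun x : R => x <= q ^+ 2)); first exact: closed_le.
near=> m; have m0 : (0 < m)%N by near: m; exact: nbhs_infty_gt.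
apply: (dimq_ratio_le q q01).
  by move=> i; rewrite size_lam_theta => im; rewrite bt_lam_theta.
apply/negP => /eqP e; have := bt_lam_theta theta m 0 m0.
rewrite e size_lam_theta bt_nseq// => e'.
by move: theta0; rewrite -e' ltxx.
Unshelve. all: by end_near. Qed.

(** The [i]-th smallest entry does not increase with the level and is at least [theta i], hence it
    stabilizes. For [i] at least [k] its two bounds are both [c]. *)
Lemma support_stable (w : OmegaM) : in_support P w -> exists N, forall n, (N <= n)%N ->
  vert w n = nseq (n - N) c ++ vert w N.
Proof.
move=> sw.
have sb n i : (i < n)%N -> theta i <= bt (vert w n) i <= c.
  move=> i_n; have [m _ /(_ i i_n)/andP[-> h]] := support_bt q theta P q01 Pt w n sw.
  exact: le_trans h (theta_c _).
have stab1 i : exists N, forall n, (N <= n)%N -> bt (vert w n) i = bt (vert w N) i.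
  have [||j hj] := eventually_const (fun j => - bt (vert w (i.+1 + j)) i) (- theta i).
  - move=> j; rewrite lerN2 addnS.
    have := interlace_bt _ _ i (vert_interlace w (i.+1 + j)).
    by rewrite size_vert => /(_ _)/andP[]//; lia.
  - by move=> j; rewrite lerN2; have /andP[] := sb (i.+1 + j)%N i ltac:(lia).
  exists (i.+1 + j)%N => n jn; have := hj (n - i.+1)%N ltac:(lia).
  by rewrite subnKC ?(leq_trans _ jn) ?leq_addr// => /oppr_inj.
(* One level after which the finitely many entries of index below [k] are all stable; being at least
   [k], it also makes every entry gained later equal to [c]. *)
have [N [kN hN]] : exists N, (k <= N)%N /\ forall n i, (N <= n)%N -> (i < k)%N ->
    bt (vert w n) i = bt (vert w N) i.
  elim: (k) => [|K [N [KN hN]]]; first by exists 0%N.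
  have [M hM] := stab1 K; exists (maxn K.+1 (maxn N M)); split; first exact: leq_maxl.
  move=> n i; rewrite !geq_max => /and3P[_ Nn Mn]; rewrite ltnS leq_eqVlt => /orP[/eqP ->|iK].
    by rewrite (hM n Mn) hM// !leq_max leqnn !orbT.
  by rewrite (hN n i Nn iK) hN// !leq_max leqnn !orbT.
exists N => n Nn; apply: eq_from_bt.
  by rewrite size_cat size_nseq !size_vert subnK.
move=> i; rewrite size_vert => i_n.
rewrite [RHS]/bt rev_cat nth_cat size_rev size_vert -/(bt _ _); case: ltnP => iN.
  case: (ltnP i k) => ik; first exact: hN.
  have /andP[a1 a2] := sb n i i_n; have /andP[a3 a4] := sb N i iN.
  rewrite theta_k// in a1 a3.
  by apply/eqP; rewrite eq_le (le_trans a2 a3) (le_trans a4 a1).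
rewrite -/(bt _ _) bt_nseq; last by lia.
have /andP[a1 a2] := sb n i i_n; rewrite theta_k in a1; last exact: leq_trans iN.
by apply/eqP; rewrite eq_le a2.
Qed.

Lemma ae_countable : {ae P, forall w, exists i : nat * seq (seq int),
  (forall n, (i.1 <= n)%N -> vert w n = nseq (n - i.1) c ++ vert w i.1) /\ trunc w i.1 = i.2}.
Proof.
apply: filterS (ae_support P) => w /support_stable[N hN].
by exists (N, trunc w N).
Qed.

Lemma charged_point (A : set OmegaM) : measurable A -> (0 < P A)%E ->
  exists2 w, A w & (0 < P [set w])%E.
Proof.
apply: (atoms_of_countable P _ _ _ ae_countable).
move=> [N a] w w' /= [h e] [h' e'].
have ww' : trunc w N = trunc w' N by rewrite e.
move/trunc_eqP: ww' => ww'; apply: vert_inj => n; case: (leqP n N) => nN; first exact: ww'.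
by rewrite h ?(ltnW nN)// h' ?(ltnW nN)// ww'.
Qed.

Let delay_raw (w : Omega) (j n : nat) : seq int := take n (vert w (maxn n j)).

(** Below level [j], two consecutive initial segments of a non-increasing row interlace; from level
    [j] on, the rows are those of [w]. *)
Let delay_ipath w j : is_ipath (delay_raw w j).
Proof.
move=> n; split; first split.
- by rewrite size_take_min size_vert; lia.
- by apply: take_sorted; have [] := vert_sign w (maxn n j).
- split; first by rewrite !size_take_min !size_vert; lia.
  move=> i; rewrite size_take_min size_vert => h.
  have i_n : (i < n)%N by lia.
  rewrite /delay_raw !nth_take ?ltnS//; last exact: ltnW.
  case: (leqP j n) => jn.
    rewrite (maxn_idPl (leqW jn)).
    by have [_] := vert_interlace w n; rewrite size_vert; exact.
  rewrite (maxn_idPr jn) lexx andbT.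
  have [sv] := vert_sign w j.
  move=> /(sortedP 0); apply; rewrite sv; lia.
Qed.

(* The rows of [delay w j] below level [j] are the initial segments of row [j]
   of [w]: the small entries come in as late as possible. *)
Let delay w j : Omega := exist _ _ (delay_ipath w j).

Lemma nonconstant_atomic : atomic_infinite P.
Proof.
split.
  move=> A mA PA; have [w Aw Pw] := charged_point A mA PA.
  by exists [set w]; split; [move=> _ ->|exact: atom_set1].
have fs : from_star [:: [::]; [:: c]].
  split=> //; split=> //; split.
    by move=> [|[|]]//= _; split.
  by move=> [|[|]]//= _; split.
have mc := measurable_cyl _ fs.
(* As [q ^+ 2 < 1], some charged path has a first row other than [[:: c]]; its least entry is then
   below [c] at every level. *)
have Pc : (0 < P (~` (cyl [:: [::]; [:: c]])))%E.
  rewrite probability_setC// sube_gt0 -[X in (X < _)%E]fineK ?fin_numP// lte_fin.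
  rewrite (le_lt_trans first_row_le)//; have [q0 q1] := andP q01.
  by rewrite exprn_ilt1// ltW.
have [w wc Pw] := charged_point _ (measurableC mc) Pc.
have sw : in_support P w.
  move=> n e; move: Pw; rewrite ltNge; apply/negP; rewrite negbK -e le_measure ?inE//.
  - exact: measurable_set1_Omega.
  - exact: (measurable_cyl _ (trunc_from_star w n)).
  - by move=> _ ->; apply/cyl_trunc.
have w1 : bt (vert w 1) 0 < c.
  rewrite lt_neqAle; apply/andP; split; last first.
    have [m _ /(_ 0%N isT)/andP[_ h]] := support_bt q theta P q01 Pt w 1 sw.
    exact: le_trans h (theta_c _).
  apply/eqP => e; apply: wc => -[|[|]]//= _; first by rewrite vert0.
  by apply: eq_from_bt; rewrite size_vert// => -[|]//= _; rewrite e.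
have wn n : bt (vert w n.+1) 0 < c.
  elim: n => [//|n IH]; apply: le_lt_trans IH.
  have := interlace_bt _ _ 0 (vert_interlace w n.+1).
  by rewrite size_vert => /(_ isT)/andP[].
have [N0 hN0] := support_stable w sw.
(* The successor makes [N] positive, so that the levels [J i] are positive and strictly
   increasing. *)
pose N := N0.+1.
have hN n : (N <= n)%N -> vert w n = nseq (n - N) c ++ vert w N.
  move=> Nn; rewrite hN0 ?(ltnW Nn)// [vert w N]hN0// catA -nseqD.
  by congr (nseq _ _ ++ _); rewrite /N in Nn *; lia.
have tl j : tail_eq j w (delay w j).
  by move=> n jn; rewrite /= /delay_raw (maxn_idPl jn) take_oversize// size_vert.
(* With gaps of [N], row [J i'] of [w] begins with at least [J i] entries [c] whenever [i < i']. So
   at level [J i] the later delayed path is constant, while the earlier one has the row of [w], with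
   an entry below [c]. *)
pose J i := (N * i.+1)%N.
have dj i i' : (i < i')%N -> delay w (J i) <> delay w (J i').
  move=> ii' /(congr1 (fun v => bt (vert v (J i)) 0)).
  have JJ : (J i + N <= J i')%N by rewrite /J addnC -mulnS leq_mul2l; apply/orP; right.
  have J0 : (0 < J i)%N by rewrite /J muln_gt0.
  have [le1 [le2 le3]] : (J i <= J i')%N /\ (N <= J i')%N /\ (J i <= J i' - N)%N.
    by move: JJ; move: (J i) (J i') => a b; lia.
  rewrite -(tl (J i) (J i)) //= /delay_raw (maxn_idPr le1) (hN _ le2).
  rewrite takel_cat ?size_nseq// take_nseq//.
  by rewrite bt_nseq// -(prednK J0) => e; have := wn (J i).-1; rewrite e ltxx.
move=> n; exists (fun i => [set delay w (J i)]); split.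
  move=> i _; apply: atom_set1.
  exact: (point_mass q P q01 qc _ _ _ (tl (J i))).
move=> i j _ _ ij; rewrite -subset0 => v [/= -> e].
by case: (ltngtP i j) => // h; [exact: dj e|exact: dj (esym e)].
Qed.
End EventuallyConstant.

Theorem theorem1p2 (R : realType) (q : R) (theta : nat -> int)
    (P : probability OmegaM R) :
  0 < q < 1 ->
  (forall i, theta i <= theta i.+1) ->
  q_central q P ->
  is_P_theta q theta P ->
  [/\ (forall i, theta i = theta 0%N) -> atomic_single P,
      ~ (forall i, theta i = theta 0%N) ->
        (exists M : int, forall i, `|theta i| <= M) -> atomic_infinite P
    & ~ (exists M : int, forall i, `|theta i| <= M) ->
        ratio_set P = [set 0] `|` [set q ^ (2 * n) | n in [set: int]]].
Proof.
move=> q01 theta_le qc Pt; split.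
- exact: constant_atomic Pt.
- move=> nc [M hM].
  have [k hk] := eventually_const theta M theta_le (fun i => le_trans (ler_norm _) (hM i)).
  apply: (nonconstant_atomic q theta P q01 theta_le qc Pt (theta k) k hk).
  have mono := theta_mono theta theta_le.
  (* If the first term equalled the eventual value, monotonicity would make [theta] constant. *)
  rewrite lt_neqAle mono// andbT; apply/eqP => e; apply: nc => i.
  apply/eqP; rewrite eq_le (mono 0%N i)// andbT e -(hk (maxn i k)) ?leq_maxr//.
  by rewrite mono// leq_maxl.
- move=> nb; apply: ratio_setE => //; apply: (exact_ratio1 R q) => //.
  exact: (unbounded_top q theta P q01 theta_le Pt).
Qed.
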